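(* Let $\mathcal{Y}_V$ be as in the context, let $a\in V$ and $A, C\subseteq V$, and suppose that $f_{Y_CY_C}(\lambda)>0$ for all $\lambda\in\mathbb{R}$. Then, for every $t\in\mathbb{R}$, the orthogonal projection of $Y_a(t)$ on $\mathcal{L}_{Y_C}$ is $$P_{\mathcal{L}_{Y_C}}Y_a(t)=\int_{-\infty}^{\infty}e^{i\lambda t}f_{Y_aY_C}(\lambda)f_{Y_CY_C}(\lambda)^{-1}\,\Phi_C(d\lambda).$$ Furthermore, $P_{\mathcal{L}_{Y_C}}Y_a(t)$ is the solution to the optimisation problem $$\min_{\varphi_{a|C}\in L^2(f_{Y_CY_C})}\mathbb{E}\left[\left|Y_a(t)-\int_{-\infty}^{\infty}e^{i\lambda t}\varphi_{a|C}(\lambda)\,\Phi_C(d\lambda)\right|^2\right],$$ i.e. it is the random variable $\int_{-\infty}^{\infty} e^{i\lambda t}\varphi_{a|C}(\lambda)\Phi_C(d\lambda)$ attaining this minimum. Finally, $P_{\mathcal{L}_{Y_C}}Y_A(t)=(P_{\mathcal{L}_{Y_C}}Y_a(t))_{a\in A}$ can be calculated component-wise.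
   Context: $V=\{1,\dots,k\}$ and $\mathcal{Y}_V=(Y_V(t))_{t\in\mathbb{R}}$ is an $\mathbb{R}^k$-valued wide-sense stationary, mean-square continuous stochastic process with $\mathbb{E}[Y_V(t)]=0$ and a spectral density function $f_{Y_VY_V}:\mathbb{R}\to\mathbb{C}^{k\times k}$, i.e. $c_{Y_VY_V}(t)=\mathbb{E}[Y_V(t)Y_V(0)^\top]=\int_{-\infty}^\infty e^{i\lambda t}f_{Y_VY_V}(\lambda)\,d\lambda$. It has the spectral representation $Y_V(t)=\int_{-\infty}^{\infty}e^{i\lambda t}\Phi_V(d\lambda)$ with a random orthogonal measure $\Phi_V=(\Phi_1,\dots,\Phi_k)^\top$ satisfying $\mathbb{E}[\Phi_V(d\lambda)]=0$ and $\mathbb{E}[\Phi_V(d\lambda)\overline{\Phi_V(d\mu)}^\top]=\delta_{\lambda=\mu}f_{Y_VY_V}(\lambda)d\lambda$; stochastic integrals are in the usual $L^2$-sense. For $A,B\subseteq V$: $Y_A=(Y_a)_{a\in A}$, $\Phi_A=(\Phi_a)_{a\in A}$, $f_{Y_AY_B}(\lambda)=[f_{Y_VY_V}(\lambda)]_{AB}$ (the submatrix with rows in $A$ and columns in $B$). $M>0$ means that $M$ is Hermitian positive definite. $\mathcal{L}_{Y_C}$ is the mean-square closure of the complex linear span of $\{Y_c(s):c\in C,\ s\in\mathbb{R}\}$, and $P_{\mathcal{L}_{Y_C}}$ is the orthogonal projection on it in $L^2(\mathbb{P})$. $L^2(f_{Y_CY_C})$ is the set of measurable row-vector valued functions $\varphi$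 on $\mathbb{R}$ (so $\varphi(\lambda)^\top\in\mathbb{C}^{|C|}$) with $\int_{-\infty}^{\infty}|\varphi(\lambda)f_{Y_CY_C}(\lambda)\overline{\varphi(\lambda)}^\top|\,d\lambda<\infty$. Equalities of random variables are understood $\mathbb{P}$-almost surely. *)

(* Defs.v *)
From HB Require Import structures.
From mathcomp Require Import all_boot all_order all_algebra.
From mathcomp Require Export complex.
From mathcomp Require Import all_classical all_reals all_analysis.

Set Implicit Arguments.
Unset Strict Implicit.
Unset Printing Implicit Defensive.

Import Order.TTheory GRing.Theory Num.Theory numFieldNormedType.Exports.

Local Open Scope classical_set_scope.
Local Open Scope sesquilinear_scope.
Local Open Scope ring_scope.

(* In ring_scope, z^* is Num.conj, i.e. complex conjugation on R[i], and
   M^t* is the conjugate transpose of M. *)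

Section Complex.
Context {R : realType}.
Implicit Types (z : R[i]) (t : R).

Definition sqmod z : R := Normc.normc z ^+ 2.

Definition expi t : R[i] := Complex (cos t) (sin t).

Definition posdefmx n (M : 'M[R[i]]_n) : Prop :=
  M \is hermsymmx /\
  forall v : 'rV[R[i]]_n, v != 0 -> 0 < (v *m M *m v^t*) 0 0.

Context {d : measure_display} {T : measurableType d}.

Definition cmeasurable (X : T -> R[i]) : Prop :=
  measurable_fun setT (@complex.Re R \o X) /\
  measurable_fun setT (@complex.Im R \o X).

Definition cintegrable (mu : {measure set T -> \bar R}) (D : set T)
    (X : T -> R[i]) : Prop :=
  mu.-integrable D (EFin \o (@complex.Re R \o X)) /\
  mu.-integrable D (EFin \o (@complex.Im R \o X)).

Definition cintegral (mu : {measure set T -> \bar R}) (D : set T)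
    (X : T -> R[i]) : R[i] :=
  Complex (Rintegral mu D (@complex.Re R \o X))
          (Rintegral mu D (@complex.Im R \o X)).

End Complex.

Section HilbertSpace.
Context {R : realType} {d : measure_display} {T : measurableType d}.
Variable P : probability T R.
Implicit Types (X Y Z W : T -> R[i]) (L : set (T -> R[i])).

Definition cexpectation X : R[i] := cintegral P setT X.

Definition L2rv : set (T -> R[i]) :=
  [set X | cmeasurable X /\ ('E_P[sqmod \o X] < +oo)%E].

Definition inner X Y : R[i] := cexpectation (fun w => X w * (Y w)^*).

Definition ms_dist X Y : \bar R := 'E_P[fun w => sqmod (X w - Y w)].

Definition ms_cvg (X_ : nat -> T -> R[i]) X : Prop :=
  (fun n => ms_dist (X_ n) X) @ \oo --> 0%E.

Definition ms_closure L : set (T -> R[i]) :=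
  [set X | L2rv X /\
    forall e : R, 0 < e -> exists2 Z, L Z & (ms_dist X Z < e%:E)%E].

Definition is_orth_proj L X Z : Prop :=
  L Z /\ forall W, L W -> inner (fun w => X w - Z w) W = 0.

(* A version of the projection of X on L; it is unique up to P-null sets, and
   the default value 0 is not used when L is a closed subspace and X is square
   integrable. *)
Definition orth_proj L X : T -> R[i] := xget (fun=> 0) (is_orth_proj L X).

(* Projection of a random vector on the vectors with all components in L, in
   the Hilbert space of square integrable random vectors with inner product
   E[X^T conj(Y)] = \sum_i E[X_i conj(Y_i)]. *)
Definition is_vec_orth_proj n L (X Z : 'I_n -> T -> R[i]) : Prop :=
  (forall i, L (Z i)) /\
  forall W : 'I_n -> T -> R[i], (forall i, L (W i)) ->
    \sum_i inner (fun w => X i w - Z i w) (W i) = 0.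

Definition vec_orth_proj n L (X : 'I_n -> T -> R[i]) : 'I_n -> T -> R[i] :=
  xget (fun=> fun=> 0) (is_vec_orth_proj L X).

End HilbertSpace.

Section StochasticIntegral.
Context {R : realType} {d : measure_display} {T : measurableType d}.
Variable P : probability T R.
Variable m : nat.
Implicit Types (f : R -> 'M[R[i]]_m) (phi psi : R -> 'rV[R[i]]_m).
Implicit Types (Phi : 'I_m -> set R -> T -> R[i]).

Definition rv_cmeasurable phi : Prop := forall j, cmeasurable (fun l => phi l 0 j).

Definition quad_int f phi : \bar R :=
  \int[lebesgue_measure]_l
    (Normc.normc ((phi l *m f l *m (phi l)^t*) 0 0))%:E.

Definition L2spec f : set (R -> 'rV[R[i]]_m) :=
  [set phi | rv_cmeasurable phi /\ (quad_int f phi < +oo)%E].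

Record random_orthogonal_measure f Phi : Prop := {
  rom_L2 : forall a B, measurable B -> L2rv P (Phi a B) ;
  rom_mean : forall a B, measurable B -> cexpectation P (Phi a B) = 0 ;
  rom_cov : forall a b B B', measurable B -> measurable B' ->
    inner P (Phi a B) (Phi b B') =
    cintegral lebesgue_measure (B `&` B') (fun l => f l a b) ;
  rom_sigma_additive : forall a (B : nat -> set R),
    (forall n, measurable (B n)) -> trivIset setT B ->
    ms_cvg P (fun n w => \sum_(i < n) Phi a (B i) w)
             (Phi a (\bigcup_n B n)) }.

Record simple_row := {
  simple_size : nat ;
  simple_set : 'I_simple_size -> set R ;
  simple_set_measurable : forall i, measurable (simple_set i) ;
  simple_val : 'I_simple_size -> 'rV[R[i]]_m }.

Definition simple_fun (s : simple_row) : R -> 'rV[R[i]]_m := fun l =>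
  \sum_i real_complex R (\1_(simple_set (s := s) i) l) *: simple_val i.

Definition simple_int Phi (s : simple_row) : T -> R[i] := fun w =>
  \sum_i \sum_j simple_val (s := s) i 0 j * Phi j (simple_set i) w.

(* X is (a version of) the L^2-integral of phi with respect to Phi: a
   mean-square limit of integrals of simple functions converging to phi in
   L2spec f. The approximation is by row vectors, since the components of an
   element of L2spec f need not be integrable one by one. *)
Definition is_stoch_int f Phi phi (X : T -> R[i]) : Prop :=
  [/\ L2spec f phi, L2rv P X &
   exists s : nat -> simple_row,
     (fun n => quad_int f (fun l => phi l - simple_fun (s n) l)) @ \oo --> 0%E
     /\ ms_cvg P (fun n => simple_int Phi (s n)) X].

Definition stoch_int f Phi phi : T -> R[i] :=
  xget (fun=> 0) (is_stoch_int f Phi phi).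

Definition modulate (t : R) phi : R -> 'rV[R[i]]_m :=
  fun l => expi (l * t) *: phi l.

End StochasticIntegral.

Section Process.
Context {R : realType} {d : measure_display} {T : measurableType d}.
Variables (P : probability T R) (k : nat).
Variable Y : 'I_k -> R -> {RV P >-> R}.

Definition Yc (a : 'I_k) (t : R) : T -> R[i] := fun w => real_complex R (Y a t w).

Record centered_wss_msc : Prop := {
  proc_L2 : forall a t, ('E_P[fun w => (Y a t w ^+ 2)%R] < +oo)%E ;
  proc_mean0 : forall a t, ('E_P[Y a t] = 0)%E ;
  proc_stationary : forall a b t s h,
    ('E_P[fun w => (Y a (t + h)%R w * Y b (s + h)%R w)%R] =
     'E_P[fun w => (Y a t w * Y b s w)%R])%E ;
  proc_ms_continuous : forall a s,
    ('E_P[fun w => ((Y a t w - Y a s w) ^+ 2)%R])%E @[t --> s] --> 0%E }.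

Record is_spectral_density (f : R -> 'M[R[i]]_k) : Prop := {
  sd_integrable : forall a b,
    cintegrable lebesgue_measure setT (fun l => f l a b) ;
  sd_cov : forall a b t,
    inner P (Yc a t) (Yc b 0) =
    cintegral lebesgue_measure setT (fun l => expi (l * t) * f l a b) }.

(* Y_V(t) is the integral of exp(i l t) I_k against Phi_V; row a of this matrix
   integrand gives the component Y_a(t). *)
Definition spectral_representation (f : R -> 'M[R[i]]_k)
    (Phi : 'I_k -> set R -> T -> R[i]) : Prop :=
  forall a t,
    ae_eq P setT (Yc a t) (stoch_int P f Phi (fun l => row a (expi (l * t))%:M)).

Definition cspan (C : {set 'I_k}) : set (T -> R[i]) :=
  [set X | exists n (z : 'I_n -> R[i]) (c : 'I_n -> 'I_k) (s : 'I_n -> R),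
    (forall i, c i \in C) /\ X = (fun w => \sum_i z i * Yc (c i) (s i) w)].

Definition linspace (C : {set 'I_k}) : set (T -> R[i]) :=
  ms_closure P (cspan C).

End Process.

(* Rows and columns of a submatrix indexed by a subset A of 'I_k are listed in
   increasing order, through enum_val : 'I_#|A| -> 'I_k. *)
Section Restriction.
Context {R : realType} {k : nat}.
Implicit Types (A B C : {set 'I_k}) (f : R -> 'M[R[i]]_k).

Definition fsub f A B : R -> 'M[R[i]]_(#|A|, #|B|) := fun l =>
  mxsub (fun i => enum_val i) (fun j => enum_val j) (f l).

Definition frow f (a : 'I_k) C : R -> 'rV[R[i]]_#|C| := fun l =>
  \row_j f l a (enum_val j).

Definition Phisub (T : Type) (Phi : 'I_k -> set R -> T -> R[i]) C :
  'I_#|C| -> set R -> T -> R[i] := fun j => Phi (enum_val j).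

End Restriction.

Arguments Phisub {R k T} Phi C.

Definition is_minimiser (U : Type) (R : realType) (D : set U) (J : U -> \bar R)
    (x : U) : Prop :=
  D x /\ forall y, D y -> (J x <= J y)%E.

(* Main.v *)
(* The map sending a row function phi to its stochastic integral is a linear
   isometry from L^2(f) into L^2(P): this holds for step functions by the
   covariance of Phi and extends by density and completeness.  Orthogonality in
   L^2(P) can therefore be tested pointwise on the spectral side, where
   e_a - f_aC f_CC^-1 annihilates every row supported in C.  Positivity of f
   (almost everywhere, as second moments are nonnegative) bounds the form of
   f_aC f_CC^-1 by f_aa, so this row lies in L^2(f_CC).

   That stochastic integrals over C lie in the closed span of Y_C is the density
   of trigonometric polynomials in L^2(f_cc).  The bounded functions they
   approximate form an algebra closed under bounded pointwise limits; iterating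
   y |-> (3 y - y^3) / 2 on sin ((x - a) / n) and letting n grow gives
   sgn (x - a), hence half-lines, hence all Borel sets. *)
Require Import Defs.
From HB Require Import structures.
From mathcomp Require Import all_boot all_order all_algebra.
From mathcomp Require Import all_classical all_reals all_analysis.
From mathcomp Require Import measurable_realfun ring lra.

Import Order.TTheory GRing.Theory Num.Theory numFieldNormedType.Exports.
Local Open Scope classical_set_scope.
Local Open Scope ring_scope.

Set Implicit Arguments.
Unset Strict Implicit.
Unset Printing Implicit Defensive.

(** * Complex-valued integrals *)

(** All estimates are made on squared norms, through |x + y|^2 <= (1 + e)|x|^2 + (1 + 1/e)|y|^2.
    This holds in L^2(P) and, by positivity of the form at x - y/e, in L^2(f). Taking e = 1 serves
    the approximation arguments; letting e tend to 0 gives equality of norms, so norms never have to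
    be extracted from their squares.

    Outside the block of [C], the matrix f is known only through its integrable entries and the
    covariance of [Phi]. That its form is nonnegative, or even real, has to be derived, and holds
    off a null set that depends on the row function. Countably many step functions yield it for any
    measurable row; four constant rows for each pair of indices yield hermitian symmetry.

    Only the norm identity is extended from step functions to L^2(f). Orthogonality is recovered
    from it by asking for Pythagoras with all complex multiples of one of the two variables. Rows
    indexed by [C] are extended by zero, so that this computation takes place in the form of the
    full matrix. *)

Section ComplexNumbers.
Context {R : realType}.
Implicit Types (z w : R[i]).

Lemma ReD z w : complex.Re (z + w) = complex.Re z + complex.Re w.
Proof. by case: z w => [a b] [c d]. Qed.

Lemma ImD z w : complex.Im (z + w) = complex.Im z + complex.Im w.
Proof. by case: z w => [a b] [c d]. Qed.

Lemma ReN z : complex.Re (- z) = - complex.Re z.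
Proof. by case: z => [a b]. Qed.

Lemma ImN z : complex.Im (- z) = - complex.Im z.
Proof. by case: z => [a b]. Qed.

Lemma ReM z w :
  complex.Re (z * w) = complex.Re z * complex.Re w - complex.Im z * complex.Im w.
Proof. by case: z w => [a b] [c d]. Qed.

Lemma ImM z w :
  complex.Im (z * w) = complex.Re z * complex.Im w + complex.Im z * complex.Re w.
Proof. by case: z w => [a b] [c d]. Qed.

Lemma ReC z : complex.Re z^* = complex.Re z.
Proof. by case: z => [a b]. Qed.

Lemma ImC z : complex.Im z^* = - complex.Im z.
Proof. by case: z => [a b]. Qed.

Lemma complexP z w :
  complex.Re z = complex.Re w -> complex.Im z = complex.Im w -> z = w.
Proof. by case: z w => [a b] [c d] /= -> ->. Qed.

Lemma sqmodE z : sqmod z = complex.Re z ^+ 2 + complex.Im z ^+ 2.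
Proof.
by case: z => a b; rewrite /sqmod /= sqr_sqrtr // addr_ge0 // sqr_ge0.
Qed.

Lemma sqmod_ge0 z : 0 <= sqmod z.
Proof. exact: sqr_ge0. Qed.

Lemma sqmod_eq0 z : sqmod z = 0 -> z = 0.
Proof. by move=> /eqP; rewrite sqrf_eq0 => /eqP /Normc.eq0_normc. Qed.

Lemma sqmodM z w : sqmod (z * w) = sqmod z * sqmod w.
Proof. by rewrite /sqmod Normc.normcM exprMn. Qed.

Lemma mulcJ z : z * z^* = real_complex R (sqmod z).
Proof. by apply: complexP; rewrite ?ReM ?ImM ReC ImC /= ?sqmodE; ring. Qed.

Lemma sqmodN z : sqmod (- z) = sqmod z.
Proof. by rewrite !sqmodE ReN ImN !sqrrN. Qed.

Lemma sqmod_expi (t : R) : sqmod (expi t) = 1.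
Proof. by rewrite sqmodE /= cos2Dsin2. Qed.

Lemma expiD (s t : R) : expi (s + t) = expi s * expi t.
Proof.
by apply: complexP; rewrite ?ReM ?ImM /= ?cosD ?sinD; ring.
Qed.

Lemma conj_real (x : R) : (real_complex R x)^* = real_complex R x.
Proof. by apply: complexP; rewrite ?ReC ?ImC //= oppr0. Qed.

End ComplexNumbers.

Section RealIntegrals.
Context {d : measure_display} {T : measurableType d} {R : realType}.
Variable mu : {measure set T -> \bar R}.
Implicit Types (g h : T -> R).

Definition rintegrable g : Prop := mu.-integrable setT (EFin \o g).

Definition rint g : R := Rintegral mu setT g.

Lemma rintegrable_measurable g : rintegrable g -> measurable_fun setT g.
Proof. by move=> /measurable_int /measurable_EFinP. Qed.

Lemma rintegrableD g h : rintegrable g -> rintegrable h ->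
  rintegrable (fun x => g x + h x).
Proof. by move=> ig ih; exact: (integrableD measurableT ig ih). Qed.

Lemma rintegrableZ (a : R) g : rintegrable g -> rintegrable (fun x => a * g x).
Proof. by move=> ig; exact: (integrableZl measurableT _ ig). Qed.

Lemma rintegrableB g h : rintegrable g -> rintegrable h ->
  rintegrable (fun x => g x - h x).
Proof. by move=> ig ih; exact: (integrableB measurableT ig ih). Qed.

Lemma rintegrable0 : rintegrable (fun=> 0).
Proof. exact: integrable0. Qed.

Lemma rintegrable_sum (I : Type) (r : seq I) (h : I -> T -> R) :
  (forall i, rintegrable (h i)) -> rintegrable (fun x => \sum_(i <- r) h i x).
Proof.
move=> ih; elim: r => [|i r IH].
  by under eq_fun do rewrite big_nil; exact: rintegrable0.
by under eq_fun do rewrite big_cons; exact: rintegrableD.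
Qed.

Lemma rintegrable_le g h : measurable_fun setT g ->
  (forall x, `|g x| <= h x) -> rintegrable h -> rintegrable g.
Proof.
move=> mg gh ih; apply: (le_integrable measurableT _ _ ih); first exact/measurable_EFinP.
by move=> x _ /=; rewrite lee_fin (le_trans (gh x))// ler_norm.
Qed.

Lemma rintegrable_norm g : rintegrable g -> rintegrable (fun x => `|g x|).
Proof. by move=> ig; exact: (integrable_norm ig). Qed.

Lemma EFin_rint g : rintegrable g -> (\int[mu]_x (g x)%:E = (rint g)%:E)%E.
Proof.
by move=> ig; rewrite /rint /Rintegral fineK //; exact: integrable_fin_num.
Qed.

Lemma rintD g h : rintegrable g -> rintegrable h ->
  rint (fun x => g x + h x) = rint g + rint h.
Proof. by move=> ig ih; exact: RintegralD. Qed.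

Lemma rintB g h : rintegrable g -> rintegrable h ->
  rint (fun x => g x - h x) = rint g - rint h.
Proof. by move=> ig ih; exact: RintegralB. Qed.

Lemma rintZ (a : R) g : rintegrable g -> rint (fun x => a * g x) = a * rint g.
Proof. by move=> ig; exact: RintegralZl. Qed.

Lemma rint0 : rint (fun=> 0) = 0.
Proof. by rewrite /rint /Rintegral integral0. Qed.

Lemma rint_ge0 g : (forall x, 0 <= g x) -> 0 <= rint g.
Proof. by move=> g0; exact: Rintegral_ge0. Qed.

Lemma rint_le g h : rintegrable g -> rintegrable h -> (forall x, g x <= h x) ->
  rint g <= rint h.
Proof. by move=> ig ih gh; exact: le_Rintegral. Qed.

Lemma rint_ae_eq g h : measurable_fun setT g -> measurable_fun setT h ->
  ae_eq mu setT g h -> rint g = rint h.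
Proof.
move=> mg mh gh; rewrite /rint /Rintegral; congr fine.
apply: ae_eq_integral => //; try exact/measurable_EFinP.
by apply: filterS gh => x /= e Tx; rewrite e.
Qed.

Lemma rintegrable_ae_eq g h : measurable_fun setT h -> ae_eq mu setT g h ->
  rintegrable g -> rintegrable h.
Proof.
move=> mh gh /integrableP[mg ig]; apply/integrableP; split.
  exact/measurable_EFinP.
rewrite (_ : integral _ _ _ = (\int[mu]_x `|(EFin \o g) x|)%E) //.
apply: ae_eq_integral => //.
- by apply: measurableT_comp => //; exact/measurable_EFinP.
- by apply: measurableT_comp.
by apply: filterS gh => x /= e Tx; rewrite e.
Qed.

Lemma rint_ae_ge0 g : measurable_fun setT g -> {ae mu, forall x, 0 <= g x} ->
  0 <= rint g.
Proof.
move=> mg g0; rewrite (@rint_ae_eq _ (fun x => `|g x|)) //.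
- by apply: rint_ge0.
- exact: measurableT_comp.
by apply: filterS g0 => x /= gx _; rewrite ger0_norm.
Qed.

Lemma rint_ae_le g h : rintegrable g -> rintegrable h ->
  {ae mu, forall x, g x <= h x} -> rint g <= rint h.
Proof.
move=> ig ih gh; rewrite -subr_ge0 -rintB //; apply: rint_ae_ge0.
  by apply: rintegrable_measurable; exact: rintegrableB.
by apply: filterS gh => x; rewrite subr_ge0.
Qed.

Lemma rint_eq0_ae g : rintegrable g -> (forall x, 0 <= g x) -> rint g = 0 ->
  {ae mu, forall x, g x = 0}.
Proof.
move=> ig g0 g1; have mg := rintegrable_measurable ig.
have mEg : measurable_fun setT (EFin \o g) by exact/measurable_EFinP.
have /(ae_eq_integral_abs mu measurableT mEg) :
    (\int[mu]_(x in setT) `|(EFin \o g) x| = 0)%E.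
  under eq_integral => x _ do rewrite /= ger0_norm //.
  by rewrite EFin_rint // g1.
by apply: filterS => x /= /(_ I) [].
Qed.

Lemma rint_dominated_cvg0 (g_ : nat -> T -> R) h :
  (forall n, measurable_fun setT (g_ n)) -> rintegrable h ->
  (forall n x, `|g_ n x| <= h x) -> (forall x, g_ ^~ x @ \oo --> 0) ->
  (fun n => rint (g_ n)) @ \oo --> 0.
Proof.
move=> mg ih gh g0.
have ig n : rintegrable (g_ n) by exact: rintegrable_le ih.
have [] := @dominated_convergence _ _ _ mu setT measurableT
  (fun n => EFin \o g_ n) (cst 0%E) (EFin \o h).
- by move=> n; exact/measurable_EFinP.
- exact: measurable_cst.
- by apply: aeW => x _ /=; apply: cvg_EFin; [exact: nearW|exact: g0].
- exact: ih.
- by apply: aeW => x n _ /=; rewrite lee_fin.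
move=> _ _; rewrite integral0 => /fine_cvg /=.
by apply: cvg_trans; apply: near_eq_cvg; apply: nearW.
Qed.
End RealIntegrals.

Section AlmostEverywhere.
Context {d : measure_display} {T : measurableType d} {R : realType}.
Variable mu : {measure set T -> \bar R}.
Implicit Types A B C : T -> Prop.

Lemma ae_imp A B : (forall x, A x -> B x) ->
  {ae mu, forall x, A x} -> {ae mu, forall x, B x}.
Proof. by move=> AB; apply: filterS. Qed.

Lemma ae_imp2 A B C : (forall x, A x -> B x -> C x) ->
  {ae mu, forall x, A x} -> {ae mu, forall x, B x} -> {ae mu, forall x, C x}.
Proof. by move=> ABC; apply: filterS2. Qed.

Lemma ae_forall_fin (I : finType) (Q : I -> T -> Prop) :
  (forall i, {ae mu, forall x, Q i x}) -> {ae mu, forall x, forall i, Q i x}.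
Proof. exact: filter_forall. Qed.
End AlmostEverywhere.

Section ComplexIntegrals.
Context {d : measure_display} {T : measurableType d} {R : realType}.
Implicit Types (X Y : T -> R[i]).

Lemma cmeasurable_cst (z : R[i]) : cmeasurable (fun _ : T => z).
Proof. by split; exact: measurable_cst. Qed.

Lemma cmeasurableD X Y : cmeasurable X -> cmeasurable Y ->
  cmeasurable (fun x => X x + Y x).
Proof.
move=> [a b] [c e]; split; rewrite /comp.
  by under eq_fun do rewrite ReD; exact: measurable_funD.
by under eq_fun do rewrite ImD; exact: measurable_funD.
Qed.

Lemma cmeasurableM X Y : cmeasurable X -> cmeasurable Y ->
  cmeasurable (fun x => X x * Y x).
Proof.
move=> [a b] [c e]; split; rewrite /comp.
  under eq_fun do rewrite ReM.
  by apply: measurable_funB; exact: measurable_funM.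
under eq_fun do rewrite ImM.
by apply: measurable_funD; exact: measurable_funM.
Qed.

Lemma cmeasurableJ X : cmeasurable X -> cmeasurable (fun x => (X x)^*).
Proof.
move=> [a b]; split; rewrite /comp.
  by under eq_fun do rewrite ReC.
by under eq_fun do rewrite ImC; exact: measurableT_comp.
Qed.

Lemma cmeasurableN X : cmeasurable X -> cmeasurable (fun x => - X x).
Proof.
move=> [a b]; split; rewrite /comp.
  by under eq_fun do rewrite ReN; exact: measurableT_comp.
by under eq_fun do rewrite ImN; exact: measurableT_comp.
Qed.

Lemma cmeasurableB X Y : cmeasurable X -> cmeasurable Y ->
  cmeasurable (fun x => X x - Y x).
Proof. by move=> mX mY; apply: cmeasurableD => //; exact: cmeasurableN. Qed.

Lemma cmeasurable_sum (I : Type) (r : seq I) (X : I -> T -> R[i]) :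
  (forall i, cmeasurable (X i)) -> cmeasurable (fun x => \sum_(i <- r) X i x).
Proof.
move=> mX; elim: r => [|i r IH].
  by under eq_fun do rewrite big_nil; exact: cmeasurable_cst.
by under eq_fun do rewrite big_cons; exact: cmeasurableD.
Qed.

Lemma cmeasurable_prod (I : Type) (r : seq I) (X : I -> T -> R[i]) :
  (forall i, cmeasurable (X i)) -> cmeasurable (fun x => \prod_(i <- r) X i x).
Proof.
move=> mX; elim: r => [|i r IH].
  by under eq_fun do rewrite big_nil; exact: cmeasurable_cst.
by under eq_fun do rewrite big_cons; exact: cmeasurableM.
Qed.

Lemma cmeasurable_real (g : T -> R) : measurable_fun setT g ->
  cmeasurable (fun x => real_complex R (g x)).
Proof. by move=> mg; split => //; exact: measurable_cst. Qed.

Lemma measurable_sqmod X : cmeasurable X -> measurable_fun setT (@sqmod R \o X).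
Proof.
move=> [a b]; rewrite /comp; under eq_fun do rewrite sqmodE.
by apply: measurable_funD; exact: measurable_funX.
Qed.

Lemma measurable_normc X : cmeasurable X ->
  measurable_fun setT (@Normc.normc R \o X).
Proof.
move=> mX; have /= ms := measurable_sqmod mX.
have -> : @Normc.normc R \o X = @Num.sqrt R \o (@sqmod R \o X).
  apply/funext => x /=; rewrite /sqmod sqrtr_sqr ger0_norm //.
  by case: (X x) => a b /=; exact: sqrtr_ge0.
apply: (measurableT_comp _ ms); apply: continuous_measurable_fun.
exact: sqrt_continuous.
Qed.

Lemma cmeasurableV X : cmeasurable X -> cmeasurable (fun x => (X x)^-1).
Proof.
move=> mX.
(* 1/z = conj(z)/|z|^2 holds at z = 0 too, where inverses are 0 by convention; this reduces the
   complex inverse to a real one. *)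
have -> : (fun x => (X x)^-1) =
    (fun x => (X x)^* * real_complex R (sqmod (X x))^-1).
  apply/funext => x; have [->|X0] := eqVneq (X x) 0.
    by rewrite invr0 rmorph0 mul0r.
  apply: (mulfI X0); rewrite divff // mulrA mulcJ -rmorphM /= divff //.
  by apply: contra X0 => /eqP/sqmod_eq0 ->.
apply: cmeasurableM; first exact: cmeasurableJ.
apply: cmeasurable_real; under eq_fun do rewrite -powR_inv1 ?sqmod_ge0 //.
by apply: (measurableT_comp (measurable_powR _)); exact: measurable_sqmod.
Qed.

Lemma cmeasurable_expi (h : T -> R) : measurable_fun setT h ->
  cmeasurable (fun x => expi (h x)).
Proof.
move=> mh; split; rewrite /comp /=.
  apply: (measurableT_comp _ mh); apply: continuous_measurable_fun.
  exact: continuous_cos.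
apply: (measurableT_comp _ mh); apply: continuous_measurable_fun.
exact: continuous_sin.
Qed.

Variable mu : {measure set T -> \bar R}.
Notation cintegrable := (cintegrable mu setT).
Notation cintegral := (cintegral mu setT).

Lemma cintegrable_measurable X : cintegrable X -> cmeasurable X.
Proof. by move=> [a b]; split; [exact: rintegrable_measurable a|exact: rintegrable_measurable b]. Qed.

Lemma cintegrable0 : cintegrable (fun=> 0).
Proof. by split; exact: rintegrable0. Qed.

Lemma cintegrableD X Y : cintegrable X -> cintegrable Y ->
  cintegrable (fun x => X x + Y x).
Proof.
move=> [a b] [c e]; split; rewrite /comp.
  by under eq_fun do rewrite ReD; exact: rintegrableD.
by under eq_fun do rewrite ImD; exact: rintegrableD.
Qed.

Lemma cintegrableZ (z : R[i]) X : cintegrable X -> cintegrable (fun x => z * X x).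
Proof.
move=> [a b]; split; rewrite /comp.
  by under eq_fun do rewrite ReM; apply: rintegrableB; exact: rintegrableZ.
by under eq_fun do rewrite ImM; apply: rintegrableD; exact: rintegrableZ.
Qed.

Lemma cintegrable_sum (I : Type) (r : seq I) (X : I -> T -> R[i]) :
  (forall i, cintegrable (X i)) -> cintegrable (fun x => \sum_(i <- r) X i x).
Proof.
move=> mX; elim: r => [|i r IH].
  by under eq_fun do rewrite big_nil; exact: cintegrable0.
by under eq_fun do rewrite big_cons; exact: cintegrableD.
Qed.

Lemma normr_Re_le (z : R[i]) : `|complex.Re z| <= Normc.normc z.
Proof.
case: z => a b /=; rewrite -[leLHS]sqrtr_sqr ler_sqrt ?addr_ge0 ?sqr_ge0 //.
by rewrite lerDl sqr_ge0.
Qed.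

Lemma normr_Im_le (z : R[i]) : `|complex.Im z| <= Normc.normc z.
Proof.
case: z => a b /=; rewrite -[leLHS]sqrtr_sqr ler_sqrt ?addr_ge0 ?sqr_ge0 //.
by rewrite lerDr sqr_ge0.
Qed.

Lemma normc_ge0 (z : R[i]) : 0 <= Normc.normc z.
Proof. by case: z => a b /=; exact: sqrtr_ge0. Qed.

Lemma normc_le (z : R[i]) :
  Normc.normc z <= `|complex.Re z| + `|complex.Im z|.
Proof.
case: z => a b /=; rewrite -(@ler_pXn2r _ 2) ?nnegrE ?sqrtr_ge0 ?addr_ge0 //.
rewrite sqr_sqrtr ?addr_ge0 ?sqr_ge0 // sqrrD !real_normK ?num_real //.
by rewrite -addrA [_ *+ 2 + _]addrC addrA lerDl mulrn_wge0 // mulr_ge0.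
Qed.

Lemma cintegrable_le X (h : T -> R) : cmeasurable X ->
  (forall x, Normc.normc (X x) <= h x) -> rintegrable mu h -> cintegrable X.
Proof.
move=> [a b] Xh ih; split; apply: (rintegrable_le _ _ ih) => // x.
  exact: le_trans (normr_Re_le _) (Xh x).
exact: le_trans (normr_Im_le _) (Xh x).
Qed.

Lemma rintegrable_normc X : cintegrable X ->
  rintegrable mu (fun x => Normc.normc (X x)).
Proof.
move=> iX; have [a b] := iX.
apply: (@rintegrable_le _ _ _ _ _
  (fun x => `|complex.Re (X x)| + `|complex.Im (X x)|)).
- by apply: measurable_normc; exact: cintegrable_measurable.
- by move=> x; rewrite ger0_norm ?normc_ge0 // normc_le.
by apply: rintegrableD; exact: rintegrable_norm.
Qed.

Lemma cintegralD X Y : cintegrable X -> cintegrable Y ->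
  cintegral (fun x => X x + Y x) = cintegral X + cintegral Y.
Proof.
move=> [a b] [c e]; apply: complexP; rewrite ?ReD ?ImD /= /comp.
  by under eq_fun do rewrite ReD; exact: rintD.
by under eq_fun do rewrite ImD; exact: rintD.
Qed.

Lemma cintegralZ (z : R[i]) X : cintegrable X ->
  cintegral (fun x => z * X x) = z * cintegral X.
Proof.
move=> [a b]; apply: complexP; rewrite ?ReM ?ImM /= /comp.
  under eq_fun do rewrite ReM.
  rewrite [LHS](rintB (g := fun x => _ * _) (h := fun x => _ * _)) ?rintZ //;
  exact: rintegrableZ.
under eq_fun do rewrite ImM.
rewrite [LHS](rintD (g := fun x => _ * _) (h := fun x => _ * _)) ?rintZ //;
exact: rintegrableZ.
Qed.

Lemma cintegral0 : cintegral (fun=> 0) = 0.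
Proof. by apply: complexP => /=; exact: rint0. Qed.

Lemma cintegral_sum (I : Type) (r : seq I) (X : I -> T -> R[i]) :
  (forall i, cintegrable (X i)) ->
  cintegral (fun x => \sum_(i <- r) X i x) = \sum_(i <- r) cintegral (X i).
Proof.
move=> iX; elim: r => [|i r IH].
  by under eq_fun do rewrite big_nil; rewrite cintegral0 big_nil.
under eq_fun do rewrite big_cons.
by rewrite cintegralD ?IH ?big_cons //; exact: cintegrable_sum.
Qed.

Lemma cintegralJ X : cintegrable X ->
  cintegral (fun x => (X x)^*) = (cintegral X)^*.
Proof.
move=> [a b]; apply: complexP; rewrite ?ReC ?ImC /= /comp.
  by under eq_fun do rewrite ReC.
under eq_fun do rewrite ImC -mulN1r.
by rewrite [LHS]rintZ // mulN1r.
Qed.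

(** Brings the covariances of [Phi], which are integrals over intersections, to the whole line,
    where the linearity lemmas apply. *)
Lemma cintegral_mkcond (D : set T) X :
  Defs.cintegral mu D X = cintegral (fun x => real_complex R (\1_D x) * X x).
Proof.
have E g : Rintegral mu D g = Rintegral mu setT (fun x => \1_D x * g x).
  rewrite Rintegral_mkcond; congr Rintegral; apply/funext => x.
  by rewrite patchE indicE; case: ifP => _; rewrite ?mul1r ?mul0r.
apply: complexP; rewrite /= E; congr Rintegral; apply/funext => x /=.
  by rewrite ReM /= mul0r subr0.
by rewrite ImM /= mul0r addr0.
Qed.

Lemma cintegrable_indic (D : set T) X : measurable D -> cintegrable X ->
  cintegrable (fun x => real_complex R (\1_D x) * X x).
Proof.
move=> mD iX; apply: (@cintegrable_le _ (fun x => Normc.normc (X x))).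
- apply: cmeasurableM; last exact: cintegrable_measurable.
  by apply: cmeasurable_real; exact: measurable_indic.
- move=> x; rewrite indicE; case: (x \in D); rewrite ?mul1r //.
  by rewrite mul0r Normc.normc0 normc_ge0.
exact: rintegrable_normc.
Qed.
End ComplexIntegrals.

(** * Mean-square geometry and completeness *)

Section MeanSquare.
Context {R : realType}.

(* [2ab <= e a^2 + b^2 / e] in each coordinate *)
Lemma sqmodD_le (z w : R[i]) (e : R) : 0 < e ->
  sqmod (z + w) <= (1 + e) * sqmod z + (1 + e^-1) * sqmod w.
Proof.
move=> e0; rewrite !sqmodE ReD ImD.
have H (a b : R) : (a + b) ^+ 2 <= (1 + e) * a ^+ 2 + (1 + e^-1) * b ^+ 2.
  rewrite -subr_ge0 (_ : _ - _ = e * (a - e^-1 * b) ^+ 2); last first.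
    by field; exact: lt0r_neq0.
  by rewrite mulr_ge0 ?sqr_ge0 // ltW.
apply: le_trans (lerD (H _ _) (H _ _)) _; rewrite le_eqVlt; apply/orP; left.
by apply/eqP; ring.
Qed.

Lemma sqmodD_le2 (z w : R[i]) : sqmod (z + w) <= 2 * sqmod z + 2 * sqmod w.
Proof. by have := @sqmodD_le z w 1 ltr01; rewrite invr1. Qed.

(** A crude form of ab <= (a^2 + b^2)/2, enough to make products of square integrable variables
    integrable. *)
Lemma normcM_le_sqmod (z w : R[i]) :
  Normc.normc (z * w^*) <= sqmod z + sqmod w.
Proof.
rewrite Normc.normcM (_ : Normc.normc w^* = Normc.normc w); last first.
  by case: w => a b /=; rewrite sqrrN.
rewrite /sqmod; set a := Normc.normc z; set b := Normc.normc w.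
rewrite -subr_ge0 (_ : _ - _ = (a - b / 2) ^+ 2 + 3 / 4 * b ^+ 2); last by field.
by rewrite addr_ge0 ?sqr_ge0 // mulr_ge0 ?sqr_ge0 // divr_ge0.
Qed.

Context {d : measure_display} {T : measurableType d}.
Variable P : probability T R.
Implicit Types (X Y Z W : T -> R[i]).

Definition nrm2 X : R := rint P (fun w => sqmod (X w)).

Lemma L2rvP X : L2rv P X <->
  cmeasurable X /\ rintegrable P (fun w => sqmod (X w)).
Proof.
have E : cmeasurable X -> (\int[P]_x `|(EFin \o (fun w => sqmod (X w))) x| =
    \int[P]_x (sqmod (X x))%:E)%E.
  by move=> _; apply: eq_integral => x _ /=; rewrite ger0_norm ?sqmod_ge0.
rewrite /L2rv /= unlock; split=> -[mX iX]; split=> //.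
  apply/integrableP; split; first exact/measurable_EFinP/measurable_sqmod.
  by rewrite E.
by move/integrableP: iX => [_]; rewrite E.
Qed.

Lemma L2rv_cmeasurable X : L2rv P X -> cmeasurable X.
Proof. by move=> /L2rvP[]. Qed.

Lemma L2rv_rintegrable X : L2rv P X -> rintegrable P (fun w => sqmod (X w)).
Proof. by move=> /L2rvP[]. Qed.

Lemma L2rvD X Y : L2rv P X -> L2rv P Y -> L2rv P (fun w => X w + Y w).
Proof.
move=> /L2rvP[mX iX] /L2rvP[mY iY]; apply/L2rvP; split.
  exact: cmeasurableD.
apply: (@rintegrable_le _ _ _ _ _ (fun w => 2 * sqmod (X w) + 2 * sqmod (Y w))).
- by apply: measurable_sqmod; exact: cmeasurableD.
- by move=> w; rewrite ger0_norm ?sqmod_ge0 // sqmodD_le2.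
by apply: rintegrableD; exact: rintegrableZ.
Qed.

Lemma L2rvZ (z : R[i]) X : L2rv P X -> L2rv P (fun w => z * X w).
Proof.
move=> /L2rvP[mX iX]; apply/L2rvP; split.
  by apply: cmeasurableM => //; exact: cmeasurable_cst.
by under eq_fun do rewrite sqmodM; exact: rintegrableZ.
Qed.

Lemma L2rv0 : L2rv P (fun=> 0).
Proof.
apply/L2rvP; split; first exact: cmeasurable_cst.
under eq_fun do rewrite sqmodE /= expr0n addr0; exact: rintegrable0.
Qed.

Lemma L2rvB X Y : L2rv P X -> L2rv P Y -> L2rv P (fun w => X w - Y w).
Proof.
move=> LX /(L2rvZ (-1)) LY; under eq_fun do rewrite -mulN1r; exact: L2rvD.
Qed.

Lemma L2rv_sum (I : Type) (r : seq I) (X : I -> T -> R[i]) :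
  (forall i, L2rv P (X i)) -> L2rv P (fun w => \sum_(i <- r) X i w).
Proof.
move=> LX; elim: r => [|i r IH].
  by under eq_fun do rewrite big_nil; exact: L2rv0.
by under eq_fun do rewrite big_cons; exact: L2rvD.
Qed.

Lemma ms_distE X Y : L2rv P X -> L2rv P Y ->
  ms_dist P X Y = (nrm2 (fun w => X w - Y w))%:E.
Proof.
move=> LX LY; rewrite /ms_dist unlock; apply: EFin_rint.
by apply: L2rv_rintegrable; exact: L2rvB.
Qed.

Lemma nrm2_ge0 X : 0 <= nrm2 X.
Proof. by apply: rint_ge0 => w; exact: sqmod_ge0. Qed.

Lemma nrm2D_le X Y (e : R) : 0 < e -> L2rv P X -> L2rv P Y ->
  nrm2 (fun w => X w + Y w) <= (1 + e) * nrm2 X + (1 + e^-1) * nrm2 Y.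
Proof.
move=> e0 LX LY; have iX := L2rv_rintegrable LX; have iY := L2rv_rintegrable LY.
rewrite -!rintZ // -rintD //; try exact: rintegrableZ.
apply: rint_le.
- by apply: L2rv_rintegrable; exact: L2rvD.
- by apply: rintegrableD; exact: rintegrableZ.
by move=> w; exact: sqmodD_le.
Qed.

Lemma nrm2D_le2 X Y : L2rv P X -> L2rv P Y ->
  nrm2 (fun w => X w + Y w) <= 2 * nrm2 X + 2 * nrm2 Y.
Proof. by move=> LX LY; have := nrm2D_le ltr01 LX LY; rewrite invr1. Qed.

Lemma nrm2Z (z : R[i]) X : L2rv P X -> nrm2 (fun w => z * X w) = sqmod z * nrm2 X.
Proof.
move=> LX; rewrite /nrm2; under eq_fun do rewrite sqmodM.
by rewrite rintZ //; exact: L2rv_rintegrable.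
Qed.

Lemma nrm2BC X Y : nrm2 (fun w => X w - Y w) = nrm2 (fun w => Y w - X w).
Proof. by rewrite /nrm2; under eq_fun do rewrite -sqmodN opprB. Qed.

Lemma nrm2_eq0 X Y : L2rv P X -> L2rv P Y ->
  nrm2 (fun w => X w - Y w) = 0 -> ae_eq P setT X Y.
Proof.
move=> LX LY /rint_eq0_ae; move/(_ (L2rv_rintegrable (L2rvB LX LY))).
move/(_ (fun w => sqmod_ge0 _)); apply: filterS => w /sqmod_eq0 /eqP.
by rewrite subr_eq0 => /eqP.
Qed.

Lemma nrm2_ae_eq X Y : cmeasurable X -> cmeasurable Y -> ae_eq P setT X Y ->
  nrm2 X = nrm2 Y.
Proof.
move=> mX mY XY; apply: rint_ae_eq; try exact: measurable_sqmod.
by apply: filterS XY => w /= e Tw; rewrite e.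
Qed.

Lemma L2rv_ae_eq X Y : cmeasurable Y -> ae_eq P setT X Y -> L2rv P X -> L2rv P Y.
Proof.
move=> mY XY /L2rvP[mX iX]; apply/L2rvP; split => //.
apply: rintegrable_ae_eq iX; first exact: measurable_sqmod.
by apply: filterS XY => w /= e Tw; rewrite e.
Qed.

Lemma cintegrable_inner X Y : L2rv P X -> L2rv P Y ->
  cintegrable P setT (fun w => X w * (Y w)^*).
Proof.
move=> /L2rvP[mX iX] /L2rvP[mY iY].
apply: (@cintegrable_le _ _ _ _ _ (fun w => sqmod (X w) + sqmod (Y w))).
- by apply: cmeasurableM => //; exact: cmeasurableJ.
- by move=> w; exact: normcM_le_sqmod.
exact: rintegrableD.
Qed.

Lemma innerDl X Y Z : L2rv P X -> L2rv P Y -> L2rv P Z ->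
  inner P (fun w => X w + Y w) Z = inner P X Z + inner P Y Z.
Proof.
move=> LX LY LZ; rewrite /inner /cexpectation.
by under eq_fun do rewrite mulrDl; rewrite cintegralD //; exact: cintegrable_inner.
Qed.

Lemma innerZl (z : R[i]) X Z : L2rv P X -> L2rv P Z ->
  inner P (fun w => z * X w) Z = z * inner P X Z.
Proof.
move=> LX LZ; rewrite /inner /cexpectation.
by under eq_fun do rewrite -mulrA; rewrite cintegralZ //; exact: cintegrable_inner.
Qed.

Lemma innerJ X Y : L2rv P X -> L2rv P Y -> inner P Y X = (inner P X Y)^*.
Proof.
move=> LX LY; rewrite /inner /cexpectation -cintegralJ; last exact: cintegrable_inner.
by under [in RHS]eq_fun do rewrite rmorphM /= conjCK mulrC.
Qed.

Lemma inner0l Z : inner P (fun=> 0) Z = 0.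
Proof.
by rewrite /inner; under eq_fun do rewrite mul0r; exact: cintegral0.
Qed.

Lemma innerBl X Y Z : L2rv P X -> L2rv P Y -> L2rv P Z ->
  inner P (fun w => X w - Y w) Z = inner P X Z - inner P Y Z.
Proof.
move=> LX LY LZ; under eq_fun do rewrite -mulN1r.
by rewrite innerDl ?innerZl ?mulN1r //; exact: L2rvZ.
Qed.

Lemma inner_suml (I : Type) (r : seq I) (X : I -> T -> R[i]) Z :
  (forall i, L2rv P (X i)) -> L2rv P Z ->
  inner P (fun w => \sum_(i <- r) X i w) Z = \sum_(i <- r) inner P (X i) Z.
Proof.
move=> LX LZ; elim: r => [|i r IH].
  by under eq_fun do rewrite big_nil; rewrite big_nil inner0l.
under eq_fun do rewrite big_cons.
by rewrite innerDl ?IH ?big_cons //; exact: L2rv_sum.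
Qed.

Lemma inner_sumr (I : Type) (r : seq I) (X : I -> T -> R[i]) Z :
  (forall i, L2rv P (X i)) -> L2rv P Z ->
  inner P Z (fun w => \sum_(i <- r) X i w) = \sum_(i <- r) inner P Z (X i).
Proof.
move=> LX LZ; rewrite innerJ //; last exact: L2rv_sum.
by rewrite inner_suml // rmorph_sum; apply: eq_bigr => i _; rewrite [RHS]innerJ.
Qed.

Lemma innerZr (z : R[i]) X Z : L2rv P X -> L2rv P Z ->
  inner P Z (fun w => z * X w) = z^* * inner P Z X.
Proof.
move=> LX LZ; rewrite innerJ //; last exact: L2rvZ.
by rewrite innerZl // rmorphM [in RHS]innerJ.
Qed.

Lemma inner_nrm2 X : L2rv P X -> inner P X X = real_complex R (nrm2 X).
Proof.
move=> LX; rewrite /inner /cexpectation; under eq_fun do rewrite mulcJ.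
by apply: complexP => //=; exact: rint0.
Qed.

Lemma nrm2D X Y : L2rv P X -> L2rv P Y ->
  nrm2 (fun w => X w + Y w) = nrm2 X + nrm2 Y + 2 * complex.Re (inner P X Y).
Proof.
move=> LX LY; have [iI _] := cintegrable_inner LX LY.
have iX := L2rv_rintegrable LX; have iY := L2rv_rintegrable LY.
rewrite /inner /cexpectation /= -rintZ // -!rintD //; last 2 first.
- exact: rintegrableD.
- exact: rintegrableZ.
congr rint; apply/funext => w /=.
by rewrite !sqmodE ReD ImD ReM ReC ImC; ring.
Qed.

(** The scalars 1 and i isolate the real and the imaginary part of the inner product. This turns the
    isometry, known for norms only, into a test for orthogonality. *)
Lemma pythagoras_inner0 X Y : L2rv P X -> L2rv P Y ->
  (forall z : R[i], nrm2 (fun w => X w + z * Y w) =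
     nrm2 X + nrm2 (fun w => z * Y w)) ->
  inner P X Y = 0.
Proof.
move=> LX LY H.
have E z : complex.Re (z^* * inner P X Y) = 0.
  have := H z; rewrite nrm2D ?innerZr //; last exact: L2rvZ.
  by move=> h; lra.
apply: complexP; rewrite /=.
  by have := E 1; rewrite rmorph1 mul1r.
have := E 'i%C; rewrite ReM ReC ImC /= => h; lra.
Qed.

Lemma inner0_pythagoras X Y : L2rv P X -> L2rv P Y -> inner P X Y = 0 ->
  nrm2 (fun w => X w + Y w) = nrm2 X + nrm2 Y.
Proof. by move=> LX LY I0; rewrite nrm2D // I0 /= mulr0 addr0. Qed.
End MeanSquare.

(** * Almost everywhere convergence and completeness of L^2(P) *)

Section Completeness.
Context {R : realType} {d : measure_display} {T : measurableType d}.

(** By monotone convergence the extended sum has integral at most K, and an integrable function is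
    finite almost everywhere. *)
Lemma ae_cvg_series (mu : {measure set T -> \bar R}) (g : nat -> T -> R)
    (c : nat -> R) (K : R) :
  (forall k x, 0 <= g k x) -> (forall k, rintegrable mu (g k)) ->
  (forall k, rint mu (g k) <= c k) -> (forall n, series c n <= K) ->
  {ae mu, forall x, cvgn (series (g ^~ x))}.
Proof.
move=> g0 ig gc cK.
have mg k : measurable_fun setT (EFin \o g k).
  by apply/measurable_EFinP; exact: rintegrable_measurable.
pose W x := (\sum_(k <oo) (g k x)%:E)%E.
have mW : measurable_fun setT W.
  apply: (@ge0_emeasurable_sum _ _ _ setT (fun k x => (g k x)%:E) predT).
    by move=> k x _ _; rewrite lee_fin.
  by move=> k _; exact: mg.
have W0 x : (0 <= W x)%E by apply: nneseries_ge0 => k _ _; rewrite lee_fin.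
have iW : mu.-integrable setT W.
  apply/integrableP; split => //.
  under eq_integral => x _ do rewrite gee0_abs //.
  rewrite integral_nneseries //; last by move=> k x _; rewrite lee_fin.
  apply: le_lt_trans (ltry K); apply: lime_le.
    by apply: is_cvg_nneseries => k _ _; apply: integral_ge0 => x _; rewrite lee_fin.
  apply: nearW => n; rewrite (eq_bigr (fun k => (rint mu (g k))%:E)); last first.
    by move=> k _; rewrite -EFin_rint.
  by rewrite sumEFin lee_fin; apply: le_trans (cK n); apply: ler_sum.
apply: filterS (integrable_ae measurableT iW) => x /(_ I) Wx.
apply: nondecreasing_is_cvgn; first exact: nondecreasing_series.
exists (fine (W x)) => _ [n _ <-].
rewrite -lee_fin fineK // /series /= -sumEFin.
by apply: nneseries_lim_ge => k _ _; rewrite lee_fin.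
Qed.

Lemma ae_cvg_of_sqr_telescope (mu : {measure set T -> \bar R}) (u : nat -> T -> R) :
  (forall k, measurable_fun setT (u k)) ->
  (forall k, rintegrable mu (fun x => (u k.+1 x - u k x) ^+ 2)) ->
  (forall k, rint mu (fun x => (u k.+1 x - u k x) ^+ 2) <= 4^-1 ^+ k) ->
  exists2 v : T -> R, measurable_fun setT v & {ae mu, forall x, u ^~ x @ \oo --> v x}.
Proof.
(* The upper limit is measurable everywhere and agrees with the limit where that exists; [fine]
   replaces infinite values by 0. *)
move=> mu_ iu u4; exists (fun x => fine (limn_esup (fun k => (u k x)%:E))).
  apply: (measurableT_comp (@fine_measurable R setT measurableT)) => //.
  by apply: measurable_fun_limn_esup => k; exact/measurable_EFinP.
have geo n : series (geometric 1 (2^-1 : R)) n <= 2.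
  rewrite geometric_seriesE; last by rewrite lt_eqF // invf_lt1 // ltr1n.
  rewrite /= mul1r -[leRHS]mul1r (_ : 1 - 2^-1 = 2^-1) ?invrK; last by field.
  by rewrite ler_wpM2r // gerBl exprn_ge0.
(* With D the k-th increment, |D| <= 2^-k + 2^k D^2. The second term has integral at most 2^k 4^-k =
   2^-k, so both terms have convergent sums almost everywhere. *)
pose g k x := 2 ^+ k * (u k.+1 x - u k x) ^+ 2.
have : {ae mu, forall x, cvgn (series (g ^~ x))}.
  apply: (@ae_cvg_series _ _ (geometric 1 2^-1) 2) => //.
  - by move=> k x; rewrite /g mulr_ge0 ?sqr_ge0 // exprn_ge0.
  - by move=> k; exact: rintegrableZ.
  move=> k; rewrite /g rintZ //= mul1r.
  apply: le_trans (ler_wpM2l _ (u4 k)) _; first exact: exprn_ge0.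
  by rewrite -exprMn (_ : 2 * 4^-1 = 2^-1) //; field.
apply: filterS => x cg.
have cu : cvgn (series (telescope (u ^~ x))).
  apply: normed_cvg; apply: (@series_le_cvg _ _
    (fun k => geometric 1 2^-1 k + g k x)) => //.
  - by move=> k; exact: normr_ge0.
  - move=> k; rewrite /= mul1r; apply: addr_ge0; first exact: exprn_ge0.
    by apply: mulr_ge0; [exact: exprn_ge0|exact: sqr_ge0].
  - move=> k; rewrite /telescope /g /geometric /= mul1r.
    set D := _ - _; rewrite -[D ^+ 2]real_normK ?num_real //.
    set a : R := 2 ^+ k; have a0 : 0 < a by rewrite exprn_gt0.
    rewrite exprVn -/a -subr_ge0.
    rewrite (_ : _ - _ = a * (`|D| - a^-1 / 2) ^+ 2 + 3 / 4 * a^-1); last first.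
      by field; exact: lt0r_neq0.
    by rewrite addr_ge0 // mulr_ge0 ?sqr_ge0 ?invr_ge0 ?divr_ge0 ?(ltW a0).
  have -> : series (fun k => geometric 1 2^-1 k + g k x) =
      series (geometric 1 2^-1) + series (g ^~ x).
    by apply/funext => n; rewrite /series /= big_split.
  apply: is_cvgD => //; apply: is_cvg_geometric_series.
  by rewrite ger0_norm // invf_lt1 // ltr1n.
have /cvg_ex[l ul] : cvgn (u ^~ x).
  have -> : u ^~ x = (fun n => u 0%N x + series (telescope (u ^~ x)) n).
    by apply/funext => n; rewrite -(eq_sum_telescope (u ^~ x)).
  by apply: is_cvgD => //; exact: is_cvg_cst.
have El : (fun k => (u k x)%:E) @ \oo --> l%:E by exact: cvg_EFin (nearW _ _) ul.
by rewrite is_cvg_limn_esupE ?(cvg_lim _ El) //; apply/cvg_ex; exists l%:E.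
Qed.
End Completeness.

Section L2Complete.
Context {R : realType} {d : measure_display} {T : measurableType d}.
Variable P : probability T R.
Implicit Types (X : nat -> T -> R[i]).

Lemma limn_einf_le (u : (\bar R)^nat) (e : \bar R) :
  (forall k, u k <= e)%E -> (limn_einf u <= e)%E.
Proof.
move=> ue; rewrite limn_einf_lim; apply: lime_le; first exact: is_cvg_einfs.
apply: nearW => n; apply: le_trans (ue n).
by apply: ereal_inf_lbound; exists n => /=.
Qed.

Lemma rint_fatou (mu : {measure set T -> \bar R}) (g : nat -> T -> R) (h : T -> R)
    (e : R) :
  (forall k, rintegrable mu (g k)) -> (forall k x, 0 <= g k x) ->
  measurable_fun setT h -> (forall x, 0 <= h x) ->
  {ae mu, forall x, g ^~ x @ \oo --> h x} ->
  (forall k, rint mu (g k) <= e) -> rintegrable mu h /\ rint mu h <= e.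
Proof.
move=> ig g0 mh h0 gh ge.
have mg k : measurable_fun setT (EFin \o g k).
  by apply/measurable_EFinP; exact: rintegrable_measurable (ig k).
have H : (\int[mu]_x (h x)%:E <= e%:E)%E.
  rewrite (@ae_eq_integral _ _ _ mu setT (fun x => limn_einf (fun k => (g k x)%:E))) //.
  - apply: le_trans (fatou _ _ mg _) _ => //; first by move=> k x _; rewrite lee_fin.
    by apply: limn_einf_le => k; rewrite EFin_rint // lee_fin.
  - exact/measurable_EFinP.
  - rewrite /limn_einf; apply: measurableT_comp => //.
    apply: (@measurable_fun_limn_esup _ _ _ _ (fun k x => - (g k x)%:E)%E) => k.
    by apply: measurableT_comp => //; exact: mg.
  apply: filterS gh => x gx _.
  have E : (fun k => (g k x)%:E) @ \oo --> (h x)%:E by exact: cvg_EFin (nearW _ _) gx.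
  by rewrite is_cvg_limn_einfE ?(cvg_lim _ E) //; apply/cvg_ex; exists (h x)%:E.
have ih : rintegrable mu h.
  apply/integrableP; split; first exact/measurable_EFinP.
  under eq_integral => x _ do rewrite /= ger0_norm //.
  exact: le_lt_trans H (ltry _).
by split => //; rewrite -lee_fin -EFin_rint.
Qed.

(** Riesz-Fischer: a fast subsequence converges almost everywhere, and Fatou's lemma along it bounds
    the distance from each late term to the limit. *)
Lemma L2rv_complete X : (forall n, L2rv P (X n)) ->
  (forall e : R, 0 < e -> exists M : nat, forall m n, (M <= m)%N -> (M <= n)%N ->
     nrm2 P (fun w => X m w - X n w) <= e) ->
  exists2 Z, L2rv P Z & forall e : R, 0 < e -> exists M : nat, forall n,
     (M <= n)%N -> nrm2 P (fun w => X n w - Z w) <= e.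
Proof.
move=> LX cauchyX.
have /choice[M MP] k : exists M : nat, forall m n, (M <= m)%N -> (M <= n)%N ->
    nrm2 P (fun w => X m w - X n w) <= 4^-1 ^+ k.
  by apply: cauchyX; rewrite exprn_gt0.
(* The maximum puts both [phi k] and [phi k.+1] beyond [M k]; the summand k makes the indices exceed
   any given bound. *)
pose phi k := (k + \max_(i < k.+1) M i)%N.
have phiM k : (M k <= phi k)%N.
  by apply: leq_trans (leq_addl _ _); exact: (leq_bigmax (@ord_max k)).
have phiS k : (M k <= phi k.+1)%N.
  apply: leq_trans (leq_addl _ _).
  exact: (leq_bigmax (@widen_ord k.+1 k.+2 (leqnSn _) ord_max)).
have step k : nrm2 P (fun w => X (phi k.+1) w - X (phi k) w) <= 4^-1 ^+ k.
  exact: MP.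
have LB m n := L2rvB (LX m) (LX n).
(* Real and imaginary parts are both 1-Lipschitz, so one argument gives a limit for each. *)
have part (pi : R[i] -> R) :
    (forall X : T -> R[i], cmeasurable X -> measurable_fun setT (pi \o X)) ->
    (forall z w, (pi z - pi w) ^+ 2 <= sqmod (z - w)) ->
    exists2 v : T -> R, measurable_fun setT v &
      {ae P, forall w, (fun k => pi (X (phi k) w)) @ \oo --> v w}.
  move=> mpi pi_le; have mX k := mpi _ (L2rv_cmeasurable (LX (phi k))).
  have i1 k : rintegrable P (fun w => (pi (X (phi k.+1) w) - pi (X (phi k) w)) ^+ 2).
    apply: rintegrable_le (L2rv_rintegrable (LB (phi k.+1) (phi k))).
      by apply: measurable_funX; apply: measurable_funB; exact: mX.
    by move=> w; rewrite ger0_norm ?sqr_ge0.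
  apply: (ae_cvg_of_sqr_telescope _ i1); first exact: mX.
  move=> k; apply: le_trans (step k); apply: (rint_le (i1 k)).
    exact: L2rv_rintegrable.
  by move=> w; exact: pi_le.
have [v1 mv1 cv1] : exists2 v : T -> R, measurable_fun setT v &
    {ae P, forall w, (fun k => complex.Re (X (phi k) w)) @ \oo --> v w}.
  apply: part => [Z []//|z w]; by rewrite sqmodE ReD ReN lerDl sqr_ge0.
have [v2 mv2 cv2] : exists2 v : T -> R, measurable_fun setT v &
    {ae P, forall w, (fun k => complex.Im (X (phi k) w)) @ \oo --> v w}.
  apply: part => [Z []//|z w]; by rewrite sqmodE ImD ImN lerDr sqr_ge0.
pose Z w := Complex (v1 w) (v2 w).
have mZ : cmeasurable Z by [].
(* The subsequence is shifted by K so that all its indices lie beyond K. The integrability obtained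
   here, at n = K, later puts [Z] in L^2. *)
have close (e : R) (K : nat) : (forall m n, (K <= m)%N -> (K <= n)%N ->
     nrm2 P (fun w => X m w - X n w) <= e) -> forall n, (K <= n)%N ->
     rintegrable P (fun w => sqmod (X n w - Z w)) /\
     nrm2 P (fun w => X n w - Z w) <= e.
  move=> He n Kn.
  apply: (@rint_fatou _ (fun k w => sqmod (X n w - X (phi (k + K)%N) w))).
  - by move=> k; exact: L2rv_rintegrable.
  - by move=> k w; exact: sqmod_ge0.
  - apply: measurable_sqmod; apply: cmeasurableB => //.
    exact: L2rv_cmeasurable.
  - by move=> w; exact: sqmod_ge0.
  - apply: filterS2 cv1 cv2 => w c1 c2; rewrite sqmodE ReD ImD ReN ImN /=.
    under eq_fun do rewrite sqmodE ReD ImD ReN ImN.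
    by apply: cvgD; rewrite !expr2; apply: cvgM; apply: cvgB;
       try exact: cvg_cst; rewrite (cvg_shiftn K (fun k => _ (X (phi k) w))).
  move=> k; apply: He => //; apply: leq_trans (leq_addr _ _).
  exact: leq_addl.
have [K KP] := cauchyX 1 ltr01.
have LZ : L2rv P Z.
  have [iK _] := close _ _ KP K (leqnn _).
  have LK : L2rv P (fun w => X K w - Z w).
    by apply/L2rvP; split => //; apply: cmeasurableB => //; exact: L2rv_cmeasurable.
  have -> : Z = (fun w => X K w - (X K w - Z w)).
    by apply/funext => w; rewrite opprB addrC subrK.
  exact: L2rvB.
exists Z => // e e0; have [Q QP] := cauchyX e e0.
by exists Q => n Qn; have [] := close _ _ QP n Qn.
Qed.

Lemma ms_cvgP X Z : (forall n, L2rv P (X n)) -> L2rv P Z ->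
  ms_cvg P X Z <-> forall e : R, 0 < e -> exists M : nat, forall n,
     (M <= n)%N -> nrm2 P (fun w => X n w - Z w) <= e.
Proof.
move=> LX LZ; rewrite /ms_cvg; under eq_fun do rewrite ms_distE //.
split=> [/fine_cvgP[_ /cvgrPdist_le c] e e0|H].
  have [M _ MP] := c e e0; exists M => n Mn.
  by have := MP n Mn; rewrite /= sub0r normrN ger0_norm ?nrm2_ge0.
apply: cvg_EFin; first exact: nearW.
apply/cvgrPdist_le => e e0; have [M MP] := H e e0; exists M => // n Mn.
by rewrite sub0r normrN ger0_norm ?nrm2_ge0 //; exact: MP.
Qed.
End L2Complete.

(** * The spectral form *)

Section SesquilinearForm.
Context {R : realType} {m : nat}.
Local Open Scope sesquilinear_scope.
Implicit Types (M : 'M[R[i]]_m) (u v : 'rV[R[i]]_m).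

Definition sq M u v : R[i] := (u *m M *m v^t*) 0 0.

Lemma sqE M u v : sq M u v = \sum_i \sum_j u 0 i * (v 0 j)^* * M i j.
Proof.
rewrite /sq mxE exchange_big; apply: eq_bigr => j _ /=.
rewrite !mxE mulr_suml; apply: eq_bigr => i _; rewrite -!mulrA.
by congr (_ * _); rewrite mulrC.
Qed.

Lemma sqDl M u v w : sq M (u + v) w = sq M u w + sq M v w.
Proof. by rewrite /sq !mulmxDl mxE. Qed.

Lemma sqZl M (z : R[i]) u v : sq M (z *: u) v = z * sq M u v.
Proof. by rewrite /sq -!scalemxAl mxE. Qed.

Lemma sqDr M u v w : sq M w (u + v) = sq M w u + sq M w v.
Proof.
rewrite !sqE -big_split; apply: eq_bigr => i _ /=; rewrite -big_split.
by apply: eq_bigr => j _; rewrite mxE rmorphD mulrDr mulrDl.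
Qed.

Lemma sqZr M (z : R[i]) u v : sq M v (z *: u) = z^* * sq M v u.
Proof.
rewrite !sqE mulr_sumr; apply: eq_bigr => i _ /=; rewrite mulr_sumr.
by apply: eq_bigr => j _; rewrite mxE rmorphM /=; ring.
Qed.

Lemma sqNl M u v : sq M (- u) v = - sq M u v.
Proof. by rewrite -scaleN1r sqZl mulN1r. Qed.

Lemma sqNr M u v : sq M u (- v) = - sq M u v.
Proof. by rewrite -scaleN1r sqZr rmorphN1 mulN1r. Qed.

Lemma sq0l M v : sq M 0 v = 0.
Proof. by rewrite /sq !mul0mx mxE. Qed.

Lemma sq0r M v : sq M v 0 = 0.
Proof. by rewrite -(scale0r (0 : 'rV_m)) sqZr rmorph0 mul0r. Qed.

Lemma sq_suml (I : Type) (r : seq I) (u : I -> 'rV[R[i]]_m) M v :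
  sq M (\sum_(i <- r) u i) v = \sum_(i <- r) sq M (u i) v.
Proof.
elim: r => [|i r IH]; first by rewrite !big_nil sq0l.
by rewrite !big_cons sqDl IH.
Qed.

Lemma sq_sumr (I : Type) (r : seq I) (u : I -> 'rV[R[i]]_m) M v :
  sq M v (\sum_(i <- r) u i) = \sum_(i <- r) sq M v (u i).
Proof.
elim: r => [|i r IH]; first by rewrite !big_nil sq0r.
by rewrite !big_cons sqDr IH.
Qed.

Lemma sq_scale M (z : R[i]) u : sq M (z *: u) (z *: u) = real_complex R (sqmod z) * sq M u u.
Proof. by rewrite sqZl sqZr mulrA mulcJ. Qed.

Lemma sq_delta M a b : sq M (delta_mx 0 a) (delta_mx 0 b) = M a b.
Proof.
rewrite sqE (bigD1 a) //= (bigD1 b) //= !big1 ?addr0.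
- by rewrite !mxE !eqxx /= mulr1n rmorph1 !mul1r.
- by move=> i ia; rewrite big1 // => j _; rewrite mxE (negbTE ia) andbF !mul0r.
by move=> j jb; rewrite !mxE (negbTE jb) andbF rmorph0 mulr0 mul0r.
Qed.

Lemma normc_sum (I : Type) (r : seq I) (z : I -> R[i]) :
  Normc.normc (\sum_(i <- r) z i) <= \sum_(i <- r) Normc.normc (z i).
Proof.
elim: r => [|i r IH]; first by rewrite !big_nil Normc.normc0.
by rewrite !big_cons; apply: le_trans (le_normcD _ _) _; rewrite lerD2l.
Qed.

Lemma normc_conj (z : R[i]) : Normc.normc z^* = Normc.normc z.
Proof. by case: z => a b /=; rewrite sqrrN. Qed.

Lemma normc_sq_le2 M u v (a b : R) :
  (forall j, Normc.normc (u 0 j) <= a) -> (forall j, Normc.normc (v 0 j) <= b) ->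
  Normc.normc (sq M u v) <= a * b * \sum_i \sum_j Normc.normc (M i j).
Proof.
move=> ua vb; rewrite sqE mulr_sumr; apply: le_trans (normc_sum _ _) _.
apply: ler_sum => i _; rewrite mulr_sumr; apply: le_trans (normc_sum _ _) _.
apply: ler_sum => j _; rewrite !Normc.normcM normc_conj.
by rewrite !ler_pM ?mulr_ge0 ?normc_ge0.
Qed.

Lemma normc_sq_le M u (e : R) : (forall j, Normc.normc (u 0 j) <= e) ->
  Normc.normc (sq M u u) <= e ^+ 2 * \sum_i \sum_j Normc.normc (M i j).
Proof. by move=> ue; rewrite expr2; exact: normc_sq_le2. Qed.

(* the polarised form of [0 <= e * sq M (u - v / e) (u - v / e)] *)
Lemma sqD_le M u v (e : R) : 0 < e ->
  0 <= sq M (u - real_complex R e^-1 *: v) (u - real_complex R e^-1 *: v) ->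
  complex.Re (sq M (u + v) (u + v)) <=
  (1 + e) * complex.Re (sq M u u) + (1 + e^-1) * complex.Re (sq M v v).
Proof.
move=> e0; rewrite lecE => /andP[_ /=].
rewrite !(sqDl, sqDr, sqNl, sqNr, sqZl, sqZr) conj_real.
rewrite !(ReD, ReN, ReM, ImM, ImN, ImD) /= => H.
rewrite -subr_ge0; apply: le_trans (mulr_ge0 (ltW e0) H) _.
rewrite le_eqVlt; apply/orP; left; apply/eqP; field; exact: lt0r_neq0.
Qed.
End SesquilinearForm.

Section SpectralForm.
Context {R : realType} {m : nat}.
Implicit Types (phi psi : R -> 'rV[R[i]]_m) (f : R -> 'M[R[i]]_m).

(** With measurability bundled, a step function is a plain list of pairs: its sets may overlap, and
    addition is concatenation. *)
Definition mset := {B : set R | measurable B}.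

Definition sstep (l : seq (mset * 'rV[R[i]]_m)) : R -> 'rV[R[i]]_m :=
  fun x => \sum_(p <- l) real_complex R (\1_(sval p.1) x) *: p.2.

Lemma rv_cmeasurableD phi psi : rv_cmeasurable phi -> rv_cmeasurable psi ->
  rv_cmeasurable (fun x => phi x + psi x).
Proof.
by move=> mp mq j; under eq_fun do rewrite mxE; exact: cmeasurableD.
Qed.

Lemma rv_cmeasurableZ (c : R -> R[i]) phi : cmeasurable c -> rv_cmeasurable phi ->
  rv_cmeasurable (fun x => c x *: phi x).
Proof.
by move=> mc mp j; under eq_fun do rewrite mxE; exact: cmeasurableM.
Qed.

Lemma rv_cmeasurable_cst (v : 'rV[R[i]]_m) : rv_cmeasurable (fun=> v).
Proof. by move=> j; exact: cmeasurable_cst. Qed.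

Lemma rv_cmeasurableB phi psi : rv_cmeasurable phi -> rv_cmeasurable psi ->
  rv_cmeasurable (fun x => phi x - psi x).
Proof.
move=> mp mq; apply: rv_cmeasurableD => //.
by under eq_fun do rewrite -scaleN1r; apply: rv_cmeasurableZ => //; exact: cmeasurable_cst.
Qed.

Lemma rv_cmeasurable_sstep l : rv_cmeasurable (sstep l).
Proof.
rewrite /sstep; elim: l => [|p l IH].
  by under eq_fun do rewrite big_nil; exact: rv_cmeasurable_cst.
under eq_fun do rewrite big_cons; apply: rv_cmeasurableD => //.
apply: rv_cmeasurableZ; last exact: rv_cmeasurable_cst.
by apply: cmeasurable_real; apply: measurable_indic; exact: (svalP p.1).
Qed.

Lemma cmeasurable_sq f phi psi : (forall a b, cmeasurable (fun x => f x a b)) ->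
  rv_cmeasurable phi -> rv_cmeasurable psi ->
  cmeasurable (fun x => sq (f x) (phi x) (psi x)).
Proof.
move=> mf mp mq; under eq_fun do rewrite sqE.
apply: cmeasurable_sum => i; apply: cmeasurable_sum => j.
by apply: cmeasurableM => //; apply: cmeasurableM => //; exact: cmeasurableJ.
Qed.

Context {d : measure_display} {T : measurableType d} (P : probability T R).
Variables (f : R -> 'M[R[i]]_m) (Phi : 'I_m -> set R -> T -> R[i]).
Hypothesis hf : forall a b, cintegrable lebesgue_measure setT (fun x => f x a b).
Hypothesis hPhi : random_orthogonal_measure P f Phi.

Let mf a b : cmeasurable (fun x => f x a b).
Proof. exact: cintegrable_measurable (hf a b). Qed.

Definition sint (l : seq (mset * 'rV[R[i]]_m)) : T -> R[i] :=
  fun w => \sum_(p <- l) \sum_j p.2 0 j * Phi j (sval p.1) w.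

Lemma L2rv_sint l : L2rv P (sint l).
Proof.
apply: L2rv_sum => p; apply: L2rv_sum => j; apply: L2rvZ.
by apply: (rom_L2 hPhi); exact: (svalP p.1).
Qed.

Lemma sq_sstep l l' x : sq (f x) (sstep l x) (sstep l' x) =
  \sum_(p <- l) \sum_(p' <- l') \sum_i \sum_j
    (p.2 0 i * (p'.2 0 j)^*) *
    (real_complex R (\1_(sval p.1 `&` sval p'.1) x) * f x i j).
Proof.
rewrite /sstep sq_suml; apply: eq_bigr => p _.
rewrite sq_sumr; apply: eq_bigr => p' _.
rewrite sqZl sqZr sqE mulrA conj_real -rmorphM mulr_sumr /=.
apply: eq_bigr => i _; rewrite mulr_sumr; apply: eq_bigr => j _.
by rewrite indicI /= !mulrA; congr (_ * _); rewrite -mulrA mulrC.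
Qed.

Lemma inner_sint l l' : inner P (sint l) (sint l') =
  cintegral lebesgue_measure setT (fun x => sq (f x) (sstep l x) (sstep l' x)).
Proof.
have LPhi (p : mset * 'rV[R[i]]_m) j : L2rv P (Phi j (sval p.1)).
  by apply: (rom_L2 hPhi); exact: (svalP p.1).
have LZ (p : mset * 'rV[R[i]]_m) j : L2rv P (fun w => p.2 0 j * Phi j (sval p.1) w).
  exact: L2rvZ.
have LS (p : mset * 'rV[R[i]]_m) : L2rv P (fun w => \sum_j p.2 0 j * Phi j (sval p.1) w).
  exact: L2rv_sum.
have iI (p p' : mset * 'rV[R[i]]_m) i j : cintegrable lebesgue_measure setT
   (fun x => real_complex R (\1_(sval p.1 `&` sval p'.1) x) * f x i j).
  by apply: cintegrable_indic => //; apply: measurableI; exact: svalP.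
under [in RHS]eq_fun do rewrite sq_sstep.
rewrite cintegral_sum; last first.
  move=> p; apply: cintegrable_sum => p'; apply: cintegrable_sum => i.
  by apply: cintegrable_sum => j; exact: cintegrableZ.
rewrite /sint inner_suml //; last by apply: L2rv_sum.
apply: eq_bigr => p _; rewrite cintegral_sum; last first.
  move=> p'; apply: cintegrable_sum => i.
  by apply: cintegrable_sum => j; exact: cintegrableZ.
rewrite inner_sumr //; apply: eq_bigr => p' _.
rewrite inner_suml // cintegral_sum; last first.
  by move=> i; apply: cintegrable_sum => j; exact: cintegrableZ.
apply: eq_bigr => i _; rewrite inner_sumr // cintegral_sum; last first.
  by move=> j; exact: cintegrableZ.
apply: eq_bigr => j _; rewrite innerZl // innerZr // mulrA.
rewrite cintegralZ; last exact: iI.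
by rewrite (rom_cov hPhi i j (svalP p.1) (svalP p'.1)) [in LHS]cintegral_mkcond.
Qed.

Lemma nrm2_sint l : nrm2 P (sint l) = rint lebesgue_measure
  (fun x => complex.Re (sq (f x) (sstep l x) (sstep l x))).
Proof.
have := inner_sint l l; rewrite inner_nrm2; last exact: L2rv_sint.
by move=> /(congr1 (@complex.Re R)).
Qed.

(* For every Borel set the integral of the form of a step function is the
   second moment of a stochastic integral. *)
Lemma sstep_ae_psd l :
  {ae (@lebesgue_measure R), forall x, 0 <= sq (f x) (sstep l x) (sstep l x)}.
Proof.
pose Q x := sq (f x) (sstep l x) (sstep l x).
have iQ : cintegrable lebesgue_measure setT Q.
  rewrite /Q; under eq_fun do rewrite sq_sstep.
  apply: cintegrable_sum => p; apply: cintegrable_sum => p'.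
  apply: cintegrable_sum => i; apply: cintegrable_sum => j; apply: cintegrableZ.
  by apply: cintegrable_indic => //; apply: measurableI; exact: svalP.
have H B : measurable B -> 0 <= cintegral lebesgue_measure B Q.
  move=> mB.
  (* Intersecting every set with B multiplies the step function by the indicator of B, so the
     integral of [Q] over B is the inner product of one random variable with itself. *)
  pose l' := [seq ((exist _ (B `&` sval p.1)
    (measurableI _ _ mB (svalP p.1)) : mset), p.2) | p <- l].
  rewrite (_ : cintegral _ _ _ = inner P (sint l') (sint l')).
    by rewrite inner_nrm2 ?lecE ?eqxx ?nrm2_ge0 //; exact: L2rv_sint.
  rewrite inner_sint [LHS]cintegral_mkcond; congr cintegral; apply/funext => x.
  have -> : sstep l' x = real_complex R (\1_B x) *: sstep l x.
    rewrite /sstep big_map scaler_sumr; apply: eq_bigr => p _.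
    by rewrite /= scalerA -rmorphM indicI.
  rewrite sq_scale; congr (_ * _); congr (real_complex R _).
  by rewrite sqmodE /= indicE; case: (x \in B); rewrite expr0n addr0 ?expr1n ?expr0n.
have [iRe iIm] := iQ.
have mRe := rintegrable_measurable iRe; have mIm := rintegrable_measurable iIm.
have Im0 : ae_eq lebesgue_measure setT (EFin \o (@complex.Im R \o Q)) (cst 0%E).
  apply: integral_ae_eq => // E _ mE; rewrite integral0.
  have := H E mE; rewrite lecE /= => /andP[/eqP E0 _].
  have iE : lebesgue_measure.-integrable E (EFin \o (@complex.Im R \o Q)).
    exact: integrableS iIm.
  rewrite -[LHS]fineK ?integrable_fin_num //; congr EFin.
  by move: E0; rewrite /Rintegral.
(* Over the set where the real part is negative its integral is nonnegative by [H], so the modulus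
   integrates to 0 there. *)
pose N := [set x | complex.Re (Q x) < 0].
have mN : measurable N.
  rewrite (_ : N = setT `&` (@complex.Re R \o Q) @^-1` `]-oo, 0[%classic).
    by apply: mRe.
  by apply/seteqP; split=> x /=; rewrite ?in_itv /=; [split|case].
have Re0 : {ae (@lebesgue_measure R), forall x,
    \1_N x * `|complex.Re (Q x)| = 0}.
  have iN : rintegrable lebesgue_measure (fun x => \1_N x * `|complex.Re (Q x)|).
    apply: rintegrable_le (rintegrable_norm iRe).
      apply: measurable_funM; first exact: measurable_indic.
      exact: measurableT_comp.
    move=> x; rewrite normrM normr_id indicE; case: (x \in N).
      by rewrite normr1 mul1r.
    by rewrite normr0 mul0r.
  apply: (rint_eq0_ae iN); first by move=> x; rewrite mulr_ge0 // indicE.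
  apply/eqP; rewrite eq_le rint_ge0 ?andbT; last first.
    by move=> x; rewrite mulr_ge0 // indicE.
  have := H N mN; rewrite cintegral_mkcond lecE /= => /andP[_].
  rewrite -oppr_ge0 -mulN1r -rintZ //.
  suff -> : @complex.Re R \o (fun x => real_complex R (\1_N x) * Q x) =
    (fun x => -1 * (\1_N x * `|complex.Re (Q x)|)) by [].
  apply/funext => x /=; rewrite ReM /= mul0r subr0 indicE.
  have [|_] := boolP (x \in N); last by rewrite !mul0r mulr0.
  by rewrite inE /N /= => Q0; rewrite ltr0_norm // !mul1r mulN1r opprK.
apply: filterS2 Im0 Re0 => x /(_ I) /= [i0] r0.
rewrite lecE /= -/(Q x) i0 eqxx /= leNgt; apply/negP => Q0.
move: r0; rewrite indicE mem_set // mul1r => /normr0P/eqP Q1.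
by move: Q0; rewrite Q1 ltxx.
Qed.
End SpectralForm.

(** * Density of step functions *)

Section StepApproximation.
Import HBSimple.
Context {R : realType} {m : nat}.
Implicit Types (phi psi : R -> 'rV[R[i]]_m) (f : R -> 'M[R[i]]_m).

Lemma sstep_cat (l1 l2 : seq (mset * 'rV[R[i]]_m)) x :
  sstep (l1 ++ l2) x = sstep l1 x + sstep l2 x.
Proof. by rewrite /sstep big_cat. Qed.

Lemma sstep_map (g : 'rV[R[i]]_m -> 'rV[R[i]]_m) (l : seq (mset * 'rV[R[i]]_m)) x :
  sstep [seq (p.1, g p.2) | p <- l] x =
  \sum_(p <- l) real_complex R (\1_(sval p.1) x) *: g p.2.
Proof. by rewrite /sstep big_map. Qed.

Lemma sstep_scale (z : R[i]) (l : seq (mset * 'rV[R[i]]_m)) x :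
  sstep [seq (p.1, z *: p.2) | p <- l] x = z *: sstep l x.
Proof.
rewrite sstep_map scaler_sumr; apply: eq_bigr => p _.
by rewrite !scalerA mulrC.
Qed.

Lemma sstep_sum (I : Type) (r : seq I) (h : I -> R -> 'rV[R[i]]_m) :
  (forall i, exists l, forall x, sstep l x = h i x) ->
  exists l, forall x, sstep l x = \sum_(i <- r) h i x.
Proof.
move=> H; elim: r => [|i r [l IH]].
  by exists [::] => x; rewrite /sstep !big_nil.
have [l' L] := H i; exists (l' ++ l) => x.
by rewrite sstep_cat big_cons L IH.
Qed.

Lemma sstep_sfun (s : {sfun R >-> R}) (h : R -> R[i]) (v : 'rV[R[i]]_m) :
  exists l, forall x, sstep l x = h (s x) *: v.
Proof.
have mB y : measurable (s @^-1` [set y]).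
  exact: measurable_funPTI.
have /finite_seqP[r rE] := fimfunP s.
exists [seq ((exist _ _ (mB y) : mset), h y *: v) | y <- undup r] => x.
have sx : s x \in undup r.
  by rewrite mem_undup; have : range s (s x) by [exists x]; rewrite rE.
rewrite /sstep big_map (bigD1_seq (s x)) //= ?big1 ?addr0 ?undup_uniq //.
- by rewrite indicE mem_set //= scale1r.
by move=> y yx; rewrite indicE memNset ?scale0r //= => sxy; rewrite sxy eqxx in yx.
Qed.

Definition clip (N y : R) : R := Num.max (- N) (Num.min N y).

Lemma clip_le (N y : R) : 0 <= N -> `|clip N y| <= N.
Proof.
move=> N0; rewrite /clip ler_norml.
by rewrite le_max lexx /= ge_max ge_min lexx /= andbT; lra.
Qed.

(** Clipping is the nearest point map onto [-N, N]: it makes approximants of a bounded function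
    uniformly bounded without spoiling their convergence. *)
Lemma clip_dist_le (N y u : R) : `|u| <= N -> `|u - clip N y| <= `|u - y|.
Proof.
move=> uN; have N0 : 0 <= N := le_trans (normr_ge0 _) uN.
move: uN; rewrite ler_norml => /andP[u1 u2]; rewrite /clip.
case: (leP N y) => Ny; [case: (leP (- N) N) | case: (leP (- N) y)] => Hy //.
- by rewrite !ler0_norm; lra.
- by lra.
by rewrite !ger0_norm; lra.
Qed.

Lemma cvgD0 (g h : nat -> R) : g @ \oo --> 0 -> h @ \oo --> 0 ->
  (fun n => g n + h n) @ \oo --> 0.
Proof.
move=> g0 h0; have e : (0 : R) + 0 = 0 by rewrite addr0.
by rewrite -[X in _ --> X]e; exact: (cvgD g0 h0).
Qed.

Lemma cvg0_sum (I : Type) (r : seq I) (h : I -> nat -> R) :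
  (forall i, h i @ \oo --> 0) -> (fun n => \sum_(i <- r) h i n) @ \oo --> 0.
Proof.
move=> H; elim: r => [|i r IH].
  by under eq_fun do rewrite big_nil; exact: cvg_cst.
under eq_fun do rewrite big_cons.
exact: cvgD0.
Qed.

Lemma sfun_cvg (u : R -> R) : measurable_fun setT u ->
  exists g : nat -> {sfun R >-> R}, forall x, (fun n => `|u x - g n x|) @ \oo --> 0.
Proof.
move=> mu; have [|g gu] := @approximation_sfun _ R R (EFin \o u) setT measurableT.
  exact/measurable_EFinP.
exists g => x; have /fine_cvgP[_ /= H] := gu x I.
rewrite (_ : 0 = `|u x - u x|); last by rewrite subrr normr0.
by apply: cvg_norm; apply: cvgB => //; exact: cvg_cst.
Qed.

(** Real and imaginary parts are approximated and clipped separately, whence the bound N + N. This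
    uniform bound is what later permits dominated convergence. *)
Lemma sstep_approx phi (N : R) : rv_cmeasurable phi ->
  (forall x j, `|complex.Re (phi x 0 j)| <= N /\ `|complex.Im (phi x 0 j)| <= N) ->
  exists l : nat -> seq (mset * 'rV[R[i]]_m),
    (forall x, (fun n => \sum_j Normc.normc ((phi x - sstep (l n) x) 0 j))
       @ \oo --> 0) /\
    forall n x j, Normc.normc (sstep (l n) x 0 j) <= N + N.
Proof.
move=> mphi phiN.
have /choice[g1 g1P] j := sfun_cvg (proj1 (mphi j)).
have /choice[g2 g2P] j := sfun_cvg (proj2 (mphi j)).
pose s n x : 'rV[R[i]]_m := \row_j Complex (clip N (g1 j n x)) (clip N (g2 j n x)).
have sE n x : s n x = \sum_j (real_complex R (clip N (g1 j n x)) *: delta_mx 0 j +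
    Complex 0 (clip N (g2 j n x)) *: delta_mx 0 j).
  rewrite [LHS]row_sum_delta; apply: eq_bigr => j _.
  by rewrite -scalerDl mxE; congr (_ *: _); apply: complexP; rewrite /= ?addr0 ?add0r.
have /choice[l lP] n : exists l, forall x, sstep l x = s n x.
  have S j : exists l, forall x, sstep l x =
      real_complex R (clip N (g1 j n x)) *: delta_mx 0 j +
      Complex 0 (clip N (g2 j n x)) *: delta_mx 0 j.
    have [l1 P1] := sstep_sfun (g1 j n) (fun y => real_complex R (clip N y))
      (delta_mx 0 j : 'rV_m).
    have [l2 P2] := sstep_sfun (g2 j n) (fun y => Complex 0 (clip N y))
      (delta_mx 0 j : 'rV_m).
    by exists (l1 ++ l2) => x; rewrite sstep_cat P1 P2.
  have [l lP] := sstep_sum (index_enum 'I_m) S.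
  by exists l => x; rewrite lP sE.
exists l; split=> [x|n x j].
  apply: cvg0_sum => j.
  have H : (fun n => `|complex.Re (phi x 0 j) - g1 j n x| +
      `|complex.Im (phi x 0 j) - g2 j n x|) @ \oo --> 0.
    exact: cvgD0 (g1P j x) (g2P j x).
  apply: (squeeze_cvgr _ (cvg_cst 0) H); apply: nearW => n.
  rewrite normc_ge0 /= (le_trans (normc_le _)) // !mxE lP !mxE ReD ImD ReN ImN /=.
  by have [a b] := phiN x j; rewrite lerD // clip_dist_le.
rewrite lP mxE; apply: le_trans (normc_le _) _ => /=.
have N0 : 0 <= N by have [a _] := phiN x j; exact: le_trans (normr_ge0 _) a.
by rewrite lerD // clip_le.
Qed.
End StepApproximation.

(** The coefficients are those of the weighted inequality at e = 1; two errors of e/4 then add up to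
    e. *)
Lemma le_of_quarters (R : realType) (a x y e : R) :
  a <= (1 + 1) * x + (1 + 1) * y -> x <= e / 4 -> y <= e / 4 -> a <= e.
Proof. by move=> H hx hy; lra. Qed.

(** Dividing by K + 1 instead of K covers K = 0. *)
Lemma scaled_quarter (R : realType) (K x e : R) : 0 <= K -> 0 <= x -> x <= e / 4 / (K + 1) ->
  K * x <= e / 4.
Proof.
move=> K0 x0; rewrite ler_pdivlMr ?ltr_wpDl // => H.
by apply: le_trans H; rewrite mulrC ler_wpM2l // lerDl.
Qed.

Lemma inv_succ_le (R : realType) (e : R) : 0 < e ->
  exists M : nat, forall n, (M <= n)%N -> n.+1%:R^-1 <= e.
Proof.
move=> e0; exists (Num.truncn e^-1) => n Mn; rewrite invf_ple ?posrE //.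
by apply: ltW; apply: lt_le_trans (truncnS_gt _) _; rewrite ler_nat ltnS.
Qed.

(** * The seminormed space L^2(f) *)

Section SpectralSpace.
Context {R : realType} {m : nat}.
Implicit Types (phi psi : R -> 'rV[R[i]]_m) (f : R -> 'M[R[i]]_m).

Lemma normc_le_sum (u : 'rV[R[i]]_m) j :
  Normc.normc (u 0 j) <= \sum_i Normc.normc (u 0 i).
Proof.
by rewrite (bigD1 j) //= lerDl sumr_ge0 // => i _; exact: normc_ge0.
Qed.

(** Being nonnegative in R[i] includes being real, so two statements pass to the limit: the
    imaginary part vanishes and the real part is nonnegative. The bound K controls the cross terms
    in s and u - s. *)
Lemma psd_limit (M : 'M[R[i]]_m) (u : 'rV[R[i]]_m) (s : nat -> 'rV[R[i]]_m) (K : R) :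
  (forall n, 0 <= sq M (s n) (s n)) ->
  (fun n => \sum_j Normc.normc ((u - s n) 0 j)) @ \oo --> 0 ->
  (forall n j, Normc.normc (s n 0 j) <= K) -> 0 <= sq M u u.
Proof.
move=> s0 su sK; set G := \sum_i \sum_j Normc.normc (M i j).
set del := fun n => _ in su.
pose c n := (K * del n + del n * K + del n * del n) * G.
have c0 : c @ \oo --> 0.
  rewrite (_ : 0 = (K * 0 + 0 * K + 0 * 0) * G); last by rewrite !(mulr0, mul0r, addr0).
  apply: cvgM; last exact: cvg_cst.
  apply: cvgD; [apply: cvgD|]; apply: cvgM => //; exact: cvg_cst.
have H n : Normc.normc (sq M u u - sq M (s n) (s n)) <= c n.
  have -> : u = s n + (u - s n) by rewrite addrC subrK.
  set r := u - s n; have rd j : Normc.normc (r 0 j) <= del n by exact: normc_le_sum.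
  have -> : sq M (s n + r) (s n + r) - sq M (s n) (s n) =
      sq M (s n) r + sq M r (s n) + sq M r r.
    by rewrite !(sqDl, sqDr); ring.
  apply: le_trans (le_normcD _ _) _; rewrite /c !mulrDl; apply: lerD.
    apply: le_trans (le_normcD _ _) _; apply: lerD.
      by apply: normc_sq_le2.
    by apply: normc_sq_le2.
  by apply: normc_sq_le2.
have Im0 : `|complex.Im (sq M u u)| <= 0.
  apply: (cvgr_to_ge c0); apply: nearW => n; apply: le_trans (H n).
  apply: le_trans (normr_Im_le _); rewrite ImD ImN.
  by have := s0 n; rewrite lecE => /andP[/eqP -> _] /=; rewrite subr0.
have Re0 : - complex.Re (sq M u u) <= 0.
  apply: (cvgr_to_ge c0); apply: nearW => n; apply: le_trans (H n).
  apply: le_trans (normr_Re_le _); rewrite ReD ReN.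
  have := s0 n; rewrite lecE => /andP[_ /= p].
  by have := ler_norm (- (complex.Re (sq M u u) - complex.Re (sq M (s n) (s n))));
     rewrite normrN; lra.
by rewrite lecE /= -normr_eq0 eq_le Im0 normr_ge0 /=; lra.
Qed.

Lemma rintegrable_le_ae {d} {T : measurableType d} (mu : {measure set T -> \bar R})
    (g h : T -> R) : measurable_fun setT g -> (forall x, 0 <= g x) ->
  {ae mu, forall x, g x <= h x} -> rintegrable mu h -> rintegrable mu g.
Proof.
move=> mg g0 gh ih; have mh := rintegrable_measurable ih.
(* The minimum is dominated everywhere by |h| and equals g almost everywhere. *)
apply: (@rintegrable_ae_eq _ _ _ _ (fun x => Num.min (g x) `|h x|)) => //.
  apply: filterS gh => x gx _; rewrite min_l //.
  exact: le_trans gx (ler_norm _).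
apply: rintegrable_le (rintegrable_norm ih).
  by apply: measurable_minr => //; exact: measurableT_comp.
by move=> x; rewrite ger0_norm ?le_min ?g0 ?normr_ge0 // ge_min lexx orbT.
Qed.

Context {d : measure_display} {T : measurableType d} (P : probability T R).
Variables (f : R -> 'M[R[i]]_m) (Phi : 'I_m -> set R -> T -> R[i]).
Hypothesis hf : forall a b, cintegrable lebesgue_measure setT (fun x => f x a b).
Hypothesis hPhi : random_orthogonal_measure P f Phi.

Let mf a b : cmeasurable (fun x => f x a b).
Proof. exact: cintegrable_measurable (hf a b). Qed.

Let G x := \sum_i \sum_j Normc.normc (f x i j).

Let iG : rintegrable lebesgue_measure G.
Proof.
by apply: rintegrable_sum => i; apply: rintegrable_sum => j; exact: rintegrable_normc.
Qed.

Lemma ae_psd phi : rv_cmeasurable phi ->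
  {ae (@lebesgue_measure R), forall x, 0 <= sq (f x) (phi x) (phi x)}.
Proof.
move=> mphi.
(* Rescaling by a positive factor preserves the sign of the form and bounds all entries by 1. The
   rescaled row is then a pointwise limit of countably many step functions, whose null sets have a
   null union. *)
pose c x := (1 + \sum_j Normc.normc (phi x 0 j))^-1.
have S0 x : 0 <= \sum_j Normc.normc (phi x 0 j).
  by apply: sumr_ge0 => j _; exact: normc_ge0.
have c0 x : 0 < c x by rewrite invr_gt0 ltr_pwDl.
pose psi x := real_complex R (c x) *: phi x.
have mc : cmeasurable (fun x => real_complex R (c x)).
  have -> : (fun x => real_complex R (c x)) =
      (fun x => (real_complex R (1 + \sum_j Normc.normc (phi x 0 j)))^-1).
    apply/funext => x; rewrite /c; exact: (fmorphV (real_complex R)).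
  apply: cmeasurableV; apply: cmeasurable_real; apply: measurable_funD => //.
  by apply: measurable_sum => j; exact: measurable_normc.
have mpsi : rv_cmeasurable psi by exact: rv_cmeasurableZ.
have psi1 x j : Normc.normc (psi x 0 j) <= 1.
  rewrite mxE Normc.normcM /= expr0n addr0 sqrtr_sqr gtr0_norm //.
  rewrite mulrC ler_pdivrMr ?mul1r; last by rewrite ltr_pwDl.
  by apply: le_trans (normc_le_sum _ _) _; rewrite lerDr.
have [l [l0 lK]] := @sstep_approx _ _ psi 1 mpsi (fun x j =>
  conj (le_trans (normr_Re_le _) (psi1 x j)) (le_trans (normr_Im_le _) (psi1 x j))).
have := ae_foralln (fun n => sstep_ae_psd hf hPhi (l n)).
apply: filterS => x s0.
have : 0 <= sq (f x) (psi x) (psi x) by exact: psd_limit s0 (l0 x) (fun n => lK n x).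
rewrite sq_scale pmulr_rge0 // ltcR sqmodE /= expr0n addr0.
by rewrite exprn_gt0.
Qed.

Definition qn phi : R := rint lebesgue_measure
  (fun x => Normc.normc (sq (f x) (phi x) (phi x))).

Lemma normc_Re_ge0 (z : R[i]) : 0 <= z -> Normc.normc z = complex.Re z.
Proof.
by case: z => a b; rewrite lecE /= => /andP[/eqP-> a0]; rewrite expr0n addr0 sqrtr_sqr ger0_norm.
Qed.

Lemma measurable_normc_sq phi : rv_cmeasurable phi ->
  measurable_fun setT (fun x => Normc.normc (sq (f x) (phi x) (phi x))).
Proof. by move=> mphi; apply: measurable_normc; exact: cmeasurable_sq. Qed.

Lemma L2specP phi : L2spec f phi <-> rv_cmeasurable phi /\
  rintegrable lebesgue_measure (fun x => Normc.normc (sq (f x) (phi x) (phi x))).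
Proof.
have E : (\int[lebesgue_measure]_x
    `|(EFin \o (fun x => Normc.normc (sq (f x) (phi x) (phi x)))) x| =
    quad_int f phi)%E.
  by apply: eq_integral => x _; exact: (congr1 EFin (ger0_norm (normc_ge0 _))).
split=> -[mphi iphi]; split=> //.
  apply/integrableP; split; first by apply/measurable_EFinP; exact: (measurable_normc_sq mphi).
  by rewrite E.
by move/integrableP: iphi => [_]; rewrite E.
Qed.

Lemma quad_intE phi : L2spec f phi -> quad_int f phi = (qn phi)%:E.
Proof. by move=> /L2specP[_]; exact: EFin_rint. Qed.

Lemma qn_ge0 phi : 0 <= qn phi.
Proof. by apply: rint_ge0 => x; exact: normc_ge0. Qed.

Lemma qnE phi : L2spec f phi -> qn phi = rint lebesgue_measure
  (fun x => complex.Re (sq (f x) (phi x) (phi x))).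
Proof.
move=> /L2specP[mphi _]; apply: rint_ae_eq.
- exact: measurable_normc_sq.
- by have [] := cmeasurable_sq mf mphi mphi.
by apply: ae_imp (ae_psd mphi) => x /normc_Re_ge0 E _.
Qed.

(** Positivity of the form at phi - psi/e, a row that depends on e; the null set may therefore
    depend on e as well. *)
Lemma ae_normc_sqD_le phi psi (e : R) : 0 < e -> rv_cmeasurable phi ->
  rv_cmeasurable psi -> {ae (@lebesgue_measure R), forall x,
  Normc.normc (sq (f x) (phi x + psi x) (phi x + psi x)) <=
  (1 + e) * Normc.normc (sq (f x) (phi x) (phi x)) +
  (1 + e^-1) * Normc.normc (sq (f x) (psi x) (psi x))}.
Proof.
move=> e0 mphi mpsi.
have mz : rv_cmeasurable (fun x => phi x - real_complex R e^-1 *: psi x).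
  by apply: rv_cmeasurableB => //; apply: rv_cmeasurableZ => //; exact: cmeasurable_cst.
apply: ae_imp2 (ae_psd mz) (ae_psd (rv_cmeasurableD mphi mpsi)) => x p1 p2.
rewrite normc_Re_ge0 //; apply: le_trans (sqD_le e0 p1) _.
have le_normc (z : R[i]) : complex.Re z <= Normc.normc z.
  exact: le_trans (ler_norm _) (normr_Re_le _).
by rewrite lerD // ler_wpM2l // addr_ge0 // ?invr_ge0 ltW.
Qed.

Lemma L2specD phi psi : L2spec f phi -> L2spec f psi ->
  L2spec f (fun x => phi x + psi x).
Proof.
move=> /L2specP[mphi iphi] /L2specP[mpsi ipsi].
have mD := rv_cmeasurableD mphi mpsi; apply/L2specP; split => //.
apply: rintegrable_le_ae (ae_normc_sqD_le ltr01 mphi mpsi) _.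
- exact: measurable_normc_sq.
- by move=> x; exact: normc_ge0.
by apply: rintegrableD; exact: rintegrableZ.
Qed.

Lemma qnD_le phi psi (e : R) : 0 < e -> L2spec f phi -> L2spec f psi ->
  qn (fun x => phi x + psi x) <= (1 + e) * qn phi + (1 + e^-1) * qn psi.
Proof.
move=> e0 Lphi Lpsi; have /L2specP[_ iD] := L2specD Lphi Lpsi.
have /L2specP[mphi iphi] := Lphi; have /L2specP[mpsi ipsi] := Lpsi.
rewrite /qn -!rintZ // -rintD; try exact: rintegrableZ.
apply: rint_ae_le => //; last exact: ae_normc_sqD_le.
by apply: rintegrableD; exact: rintegrableZ.
Qed.

Lemma normc_sq_scale (M : 'M[R[i]]_m) (z : R[i]) u :
  Normc.normc (sq M (z *: u) (z *: u)) = sqmod z * Normc.normc (sq M u u).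
Proof.
rewrite sq_scale Normc.normcM /= expr0n addr0 sqrtr_sqr ger0_norm //.
exact: sqmod_ge0.
Qed.

Lemma L2specM (c : R -> R[i]) phi (K : R) : cmeasurable c ->
  (forall x, sqmod (c x) <= K) -> L2spec f phi -> L2spec f (fun x => c x *: phi x).
Proof.
move=> mc cK /L2specP[mphi iphi]; have mcphi := rv_cmeasurableZ mc mphi.
apply/L2specP; split=> //; apply: rintegrable_le (rintegrableZ K iphi).
  exact: measurable_normc_sq.
move=> x; rewrite ger0_norm ?normc_ge0 // normc_sq_scale.
by rewrite ler_wpM2r ?normc_ge0.
Qed.

Lemma L2specZ (z : R[i]) phi : L2spec f phi -> L2spec f (fun x => z *: phi x).
Proof. by apply: (L2specM (cmeasurable_cst z) (fun=> lexx _)). Qed.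

Lemma qnZ (z : R[i]) phi : L2spec f phi ->
  qn (fun x => z *: phi x) = sqmod z * qn phi.
Proof.
move=> /L2specP[_ iphi]; rewrite /qn -rintZ //.
by congr rint; apply/funext => x; rewrite normc_sq_scale.
Qed.

Lemma L2specB phi psi : L2spec f phi -> L2spec f psi ->
  L2spec f (fun x => phi x - psi x).
Proof.
move=> Lp Lq; under eq_fun do rewrite -scaleN1r.
exact: (L2specD Lp (L2specZ (-1) Lq)).
Qed.

Lemma qnBC phi psi : qn (fun x => phi x - psi x) = qn (fun x => psi x - phi x).
Proof.
rewrite /qn; congr rint; apply/funext => x.
by rewrite -[in RHS]opprB sqNl sqNr opprK.
Qed.

Lemma L2spec_bounded phi (K : R) : rv_cmeasurable phi ->
  (forall x j, Normc.normc (phi x 0 j) <= K) -> L2spec f phi.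
Proof.
move=> mphi phiK; apply/L2specP; split=> //.
apply: rintegrable_le (rintegrableZ (K ^+ 2) iG); first exact: measurable_normc_sq.
by move=> x; rewrite ger0_norm ?normc_ge0 // normc_sq_le.
Qed.

Lemma sstep_bounded (l : seq (mset * 'rV[R[i]]_m)) :
  exists K, forall x j, Normc.normc (sstep l x 0 j) <= K.
Proof.
rewrite /sstep; elim: l => [|p l [K IH]].
  by exists 0 => x j; rewrite big_nil mxE Normc.normc0.
exists (\sum_i Normc.normc (p.2 0 i) + K) => x j; rewrite big_cons mxE.
apply: le_trans (le_normcD _ _) _; apply: lerD => //.
rewrite mxE Normc.normcM /= expr0n addr0 sqrtr_sqr indicE.
apply: le_trans (normc_le_sum _ j); case: (x \in _); rewrite ?normr1 ?mul1r //.
by rewrite normr0 mul0r normc_ge0.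
Qed.

Lemma L2spec_sstep l : L2spec f (sstep l).
Proof.
have [K lK] := sstep_bounded l.
by apply: (L2spec_bounded (rv_cmeasurable_sstep _) lK).
Qed.

Lemma nrm2_sintE l : nrm2 P (sint Phi l) = qn (sstep l).
Proof. by rewrite (nrm2_sint hf hPhi) qnE //; exact: L2spec_sstep. Qed.

Lemma sstep_dense_bounded phi (N e : R) : rv_cmeasurable phi -> 0 < e ->
  (forall x j, Normc.normc (phi x 0 j) <= N) ->
  exists l, qn (fun x => phi x - sstep l x) <= e.
Proof.
move=> mphi e0 phiN.
have [l [l0 lK]] := @sstep_approx _ _ phi N mphi (fun x j =>
  conj (le_trans (normr_Re_le _) (phiN x j)) (le_trans (normr_Im_le _) (phiN x j))).
pose del n x := \sum_j Normc.normc ((phi x - sstep (l n) x) 0 j).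
have delK n x : del n x <= \sum_(j < m) (N + (N + N)).
  apply: ler_sum => j _; rewrite mxE; apply: le_trans (le_normcD _ _) _.
  by apply: lerD => //; rewrite mxE normcN.
set K := \sum_(j < m) (N + (N + N)) in delK.
have del0 n x : 0 <= del n x by apply: sumr_ge0 => j _; exact: normc_ge0.
have : (fun n => qn (fun x => phi x - sstep (l n) x)) @ \oo --> 0.
  apply: (@rint_dominated_cvg0 _ _ _ lebesgue_measure
    (fun n x => Normc.normc (sq (f x) (phi x - sstep (l n) x) (phi x - sstep (l n) x)))
    (fun x => K ^+ 2 * G x)).
  - move=> n; apply: measurable_normc_sq; apply: rv_cmeasurableB => //.
    exact: rv_cmeasurable_sstep.
  - exact: rintegrableZ.
  - move=> n x; rewrite ger0_norm ?normc_ge0 //; apply: normc_sq_le => j.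
    exact: le_trans (normc_le_sum _ _) (delK n x).
  move=> x; apply: (@squeeze_cvgr _ _ _ _ (cst 0) (fun n => del n x ^+ 2 * G x)).
  - apply: nearW => n; rewrite normc_ge0 /=; apply: normc_sq_le => j.
    exact: normc_le_sum.
  - exact: cvg_cst.
  rewrite (_ : 0 = 0 * 0 * G x); last by rewrite !mul0r.
  by apply: cvgM; [apply: cvgM; exact: l0|exact: cvg_cst].
move=> /cvgrPdist_le/(_ _ e0)[n _ /(_ n (leqnn n))].
by rewrite sub0r normrN ger0_norm ?qn_ge0 // => H; exists (l n).
Qed.

(** The truncation multiplies the whole row by 0 or 1, so the form of phi itself is the majorant.
    Truncating entry by entry would fail, because single entries need not have finite seminorm. *)
Lemma sstep_dense phi (e : R) : L2spec f phi -> 0 < e ->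
  exists l, qn (fun x => phi x - sstep l x) <= e.
Proof.
move=> Lphi e0; have /L2specP[mphi iphi] := Lphi.
have mS : measurable_fun setT (fun x => \sum_j Normc.normc (phi x 0 j)).
  by apply: measurable_sum => j; exact: measurable_normc.
pose B (n : nat) := [set x | \sum_j Normc.normc (phi x 0 j) <= n%:R].
have mB n : measurable (B n).
  rewrite (_ : B n = setT `&`
     (fun x => \sum_j Normc.normc (phi x 0 j)) @^-1` `]-oo, n%:R]%classic).
    exact: mS.
  by apply/seteqP; split=> x /=; rewrite ?in_itv /=; [split|case].
pose tr n x := real_complex R (\1_(B n) x) *: phi x.
have mtr n : rv_cmeasurable (tr n).
  by apply: rv_cmeasurableZ => //; apply: cmeasurable_real; exact: measurable_indic.
have trE n x : phi x - tr n x = real_complex R (1 - \1_(B n) x) *: phi x.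
  by rewrite rmorphB scalerBl rmorph1 scale1r.
have : (fun n => qn (fun x => phi x - tr n x)) @ \oo --> 0.
  apply: (@rint_dominated_cvg0 _ _ _ lebesgue_measure
    (fun n x => Normc.normc (sq (f x) (phi x - tr n x) (phi x - tr n x)))
    (fun x => Normc.normc (sq (f x) (phi x) (phi x)))).
  - by move=> n; apply: measurable_normc_sq; exact: rv_cmeasurableB.
  - exact: iphi.
  - move=> n x; rewrite ger0_norm ?normc_ge0 // trE normc_sq_scale sqmodE /=.
    rewrite indicE expr0n addr0; case: (x \in B n).
      by rewrite subrr expr0n mul0r normc_ge0.
    by rewrite subr0 expr1n mul1r.
  move=> x; have [n0 n0P] : exists n0 : nat, \sum_j Normc.normc (phi x 0 j) <= n0%:R.
    exists (Num.truncn (\sum_j Normc.normc (phi x 0 j))).+1; apply: ltW.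
    exact: truncnS_gt.
  apply: cvg_near_cst; exists n0 => // n /= n0n.
  rewrite trE indicE mem_set ?subrr ?scale0r ?sq0l ?Normc.normc0 //.
  by apply: le_trans n0P _; rewrite ler_nat.
have e4 : 0 < e / 4 by rewrite divr_gt0.
move=> /cvgrPdist_le/(_ _ e4)[n _ /(_ n (leqnn n))].
rewrite sub0r normrN ger0_norm ?qn_ge0 // => Hn.
have trn x j : Normc.normc (tr n x 0 j) <= n%:R.
  rewrite mxE Normc.normcM /= expr0n addr0 sqrtr_sqr indicE.
  have [|_] := boolP (x \in B n); last by rewrite normr0 mul0r.
  rewrite inE normr1 mul1r => Bx.
  exact: le_trans (normc_le_sum _ _) Bx.
have [l lP] := sstep_dense_bounded (mtr n) e4 trn; exists l.
have Ltr : L2spec f (tr n) by exact: L2spec_bounded (mtr n) trn.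
have := qnD_le ltr01 (L2specB Lphi Ltr) (L2specB Ltr (L2spec_sstep l)).
rewrite invr1 (_ : (fun x => _ + _) = (fun x => phi x - sstep l x)).
  by move=> H; exact: (le_of_quarters H Hn lP).
by apply/funext => x; rewrite addrA subrK.
Qed.
End SpectralSpace.

(** * Stochastic integrals *)

Section StochasticIntegrals.
Context {R : realType} {m : nat}.
Implicit Types (phi psi : R -> 'rV[R[i]]_m) (f : R -> 'M[R[i]]_m).

(** The hypothesis is what two successive weighted inequalities with the same t leave when both
    errors are at most e. For e = t^2 the error terms (1 + 1/t)e become t^2 + t, which vanish with
    t. *)
Lemma le_of_quadratic_bounds (a b : R) : 0 <= b ->
  (forall t e : R, 0 < t -> 0 < e ->
     a <= (1 + t) * ((1 + t) * b + (1 + t^-1) * e) + (1 + t^-1) * e) -> a <= b.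
Proof.
move=> b0 H; apply/ler_addgt0Pr => e e0.
(* For t <= 1 the excess (2t + t^2) b + (t^3 + 3 t^2 + 2t) is at most t (3b + 6). *)
pose t := Num.min 1 (e / (3 * b + 6)).
have d0 : 0 < 3 * b + 6 by rewrite ltr_wpDl // mulr_ge0.
have t0 : 0 < t by rewrite lt_min ltr01 divr_gt0.
have t1 : t <= 1 by rewrite ge_min lexx.
have te : t * (3 * b + 6) <= e by rewrite -ler_pdivlMr // ge_min lexx orbT.
have := H t (t ^+ 2) t0 (exprn_gt0 _ t0).
rewrite (_ : (1 + t^-1) * t ^+ 2 = t ^+ 2 + t); last by field; exact: lt0r_neq0.
move=> /le_trans; apply; apply: le_trans (_ : b + t * (3 * b + 6) <= _); last by rewrite lerD2l.
rewrite -subr_ge0.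
rewrite (_ : _ - _ = t * (1 - t) * b + t * (1 - t) * (t + 4)); last by ring.
by rewrite addr_ge0 ?mulr_ge0 ?subr_ge0 ?addr_ge0 // ltW.
Qed.

Context {d : measure_display} {T : measurableType d} (P : probability T R).
Variables (f : R -> 'M[R[i]]_m) (Phi : 'I_m -> set R -> T -> R[i]).
Hypothesis hf : forall a b, cintegrable lebesgue_measure setT (fun x => f x a b).
Hypothesis hPhi : random_orthogonal_measure P f Phi.
Notation Sint := (sint Phi).

Lemma sint_cat l1 l2 w : Sint (l1 ++ l2) w = Sint l1 w + Sint l2 w.
Proof. by rewrite /sint big_cat. Qed.

Lemma sint_scale (z : R[i]) l w : Sint [seq (p.1, z *: p.2) | p <- l] w = z * Sint l w.
Proof.
rewrite /sint big_map mulr_sumr; apply: eq_bigr => p _.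
by rewrite mulr_sumr; apply: eq_bigr => j _; rewrite mxE mulrA.
Qed.

Definition seq_of_row (s : @simple_row R m) : seq (mset * 'rV[R[i]]_m) :=
  [seq ((exist _ _ (simple_set_measurable (s := s) i) : mset), simple_val i) |
    i <- index_enum 'I_(simple_size s)].

Lemma sstep_of_row s : sstep (seq_of_row s) = simple_fun s.
Proof. by apply/funext => x; rewrite /sstep big_map. Qed.

Lemma sint_of_row s : Sint (seq_of_row s) = simple_int Phi s.
Proof. by apply/funext => x; rewrite /sint big_map. Qed.

Definition row_of_seq (l : seq (mset * 'rV[R[i]]_m)) : @simple_row R m :=
  {| simple_size := size l;
     simple_set := fun i => sval (tnth (in_tuple l) i).1;
     simple_set_measurable := fun i => svalP (tnth (in_tuple l) i).1;
     simple_val := fun i => (tnth (in_tuple l) i).2 |}.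

Lemma simple_fun_of_seq l : simple_fun (row_of_seq l) = sstep l.
Proof. by apply/funext => x; rewrite /sstep big_tnth. Qed.

Lemma simple_int_of_seq l : simple_int Phi (row_of_seq l) = Sint l.
Proof. by apply/funext => x; rewrite /sint big_tnth. Qed.

Lemma quad_cvgP (g : nat -> R -> 'rV[R[i]]_m) : (forall n, L2spec f (g n)) ->
  ((fun n => quad_int f (g n)) @ \oo --> 0%E) <->
  (forall e : R, 0 < e -> exists M : nat, forall n, (M <= n)%N -> qn f (g n) <= e).
Proof.
move=> Lg; under eq_fun do rewrite (quad_intE hf (Lg _)).
split=> [/fine_cvgP[_ /cvgrPdist_le c] e e0|H].
  have [M _ MP] := c e e0; exists M => n Mn.
  by have := MP n Mn; rewrite /= sub0r normrN ger0_norm ?qn_ge0.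
apply: cvg_EFin; first exact: nearW.
apply/cvgrPdist_le => e e0; have [M MP] := H e e0; exists M => // n Mn.
by rewrite sub0r normrN ger0_norm ?qn_ge0 //; exact: MP.
Qed.

(** One step function serving both approximations replaces the sequence of the definition; for the
    converse the errors 1/(n + 1) rebuild a sequence. *)
Lemma is_stoch_intP phi X : is_stoch_int P f Phi phi X <->
  [/\ L2spec f phi, L2rv P X & forall e : R, 0 < e -> exists l,
    qn f (fun x => phi x - sstep l x) <= e /\ nrm2 P (fun w => Sint l w - X w) <= e].
Proof.
have LB l : L2spec f phi -> L2spec f (fun x => phi x - sstep l x).
  by move=> Lphi; exact: (L2specB hf hPhi Lphi (L2spec_sstep hf l)).
split=> -[Lphi LX].
  move=> [s [sphi sX]]; split => // e e0.
  have L n : L2spec f (fun x => phi x - simple_fun (s n) x).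
    by rewrite -sstep_of_row; exact: LB.
  have LS n : L2rv P (simple_int Phi (s n)).
    by rewrite -sint_of_row; exact: (L2rv_sint hPhi).
  have [M1 H1] := (quad_cvgP L).1 sphi e e0.
  have [M2 H2] := (ms_cvgP LS LX).1 sX e e0.
  exists (seq_of_row (s (maxn M1 M2))); rewrite sstep_of_row sint_of_row; split.
    by apply: H1; exact: leq_maxl.
  by apply: H2; exact: leq_maxr.
move=> H; split => //.
have /choice[l lP] n : exists l, qn f (fun x => phi x - sstep l x) <= n.+1%:R^-1 /\
    nrm2 P (fun w => Sint l w - X w) <= n.+1%:R^-1.
  by apply: H; rewrite invr_gt0.
exists (fun n => row_of_seq (l n)); split.
  apply/quad_cvgP => [n|e e0]; rewrite ?simple_fun_of_seq; first exact: LB.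
  have [M MP] := inv_succ_le e0; exists M => n Mn; rewrite simple_fun_of_seq.
  by apply: le_trans (MP n Mn); have [] := lP n.
apply/ms_cvgP => // [n|e e0]; rewrite ?simple_int_of_seq; first exact: (L2rv_sint hPhi).
have [M MP] := inv_succ_le e0; exists M => n Mn; rewrite simple_int_of_seq.
by apply: le_trans (MP n Mn); have [] := lP n.
Qed.

(** Each inequality passes through a step function, where the norms agree, at the cost of one
    weighted inequality on each side; [le_of_quadratic_bounds] then removes the parameters. *)
Lemma stoch_isometry phi X : is_stoch_int P f Phi phi X -> nrm2 P X = qn f phi.
Proof.
move=> /is_stoch_intP[Lphi LX H].
have LS l : L2rv P (Sint l) by exact: (L2rv_sint hPhi).
have Ls l : L2spec f (sstep l) by exact: (L2spec_sstep hf).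
apply/eqP; rewrite eq_le; apply/andP; split.
  apply: le_of_quadratic_bounds; first exact: qn_ge0.
  move=> t e t0 e0; have [l [h1 h2]] := H e e0.
  have E1 : X = (fun w => Sint l w + (X w - Sint l w)).
    by apply/funext => w; rewrite addrC subrK.
  rewrite [in leLHS]E1; apply: le_trans (nrm2D_le t0 (LS l) (L2rvB LX (LS l))) _.
  have s0 : 0 <= 1 + t^-1 by rewrite addr_ge0 // invr_ge0 ltW.
  apply: lerD; last by apply: (ler_wpM2l s0); rewrite nrm2BC; exact: h2.
  apply: ler_wpM2l; first exact: addr_ge0 ler01 (ltW t0).
  rewrite (nrm2_sintE hf hPhi).
  have E2 : sstep l = (fun x => phi x + (sstep l x - phi x)).
    by apply/funext => w; rewrite addrC subrK.
  rewrite [in leLHS]E2.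
  apply: le_trans (qnD_le hf hPhi t0 Lphi (L2specB hf hPhi (Ls l) Lphi)) _.
  by rewrite lerD2l; apply: (ler_wpM2l s0); rewrite qnBC; exact: h1.
apply: le_of_quadratic_bounds; first exact: nrm2_ge0.
move=> t e t0 e0; have [l [h1 h2]] := H e e0.
have E1 : phi = (fun x => sstep l x + (phi x - sstep l x)).
  by apply/funext => w; rewrite addrC subrK.
rewrite [in leLHS]E1.
apply: le_trans (qnD_le hf hPhi t0 (Ls l) (L2specB hf hPhi Lphi (Ls l))) _.
have s0 : 0 <= 1 + t^-1 by rewrite addr_ge0 // invr_ge0 ltW.
apply: lerD; last by rewrite ler_wpM2l.
apply: ler_wpM2l; first exact: addr_ge0 ler01 (ltW t0).
rewrite -(nrm2_sintE hf hPhi).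
have E2 : Sint l = (fun w => X w + (Sint l w - X w)).
  by apply/funext => w; rewrite addrC subrK.
rewrite [in leLHS]E2; apply: le_trans (nrm2D_le t0 LX (L2rvB (LS l) LX)) _.
by rewrite lerD2l ler_wpM2l.
Qed.

Lemma is_stoch_intD phi psi X Y : is_stoch_int P f Phi phi X ->
  is_stoch_int P f Phi psi Y ->
  is_stoch_int P f Phi (fun x => phi x + psi x) (fun w => X w + Y w).
Proof.
move=> /is_stoch_intP[Lp LX H1] /is_stoch_intP[Lq LY H2].
apply/is_stoch_intP; split; [exact: (L2specD hf hPhi)|exact: L2rvD|].
move=> e e0; have e4 : 0 < e / 4 by rewrite divr_gt0.
have [l1 [a1 b1]] := H1 _ e4; have [l2 [a2 b2]] := H2 _ e4.
exists (l1 ++ l2); split.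
  have -> : (fun x => phi x + psi x - sstep (l1 ++ l2) x) =
      (fun x => (phi x - sstep l1 x) + (psi x - sstep l2 x)).
    by apply/funext => x; rewrite sstep_cat opprD addrACA.
  have := qnD_le hf hPhi ltr01 (L2specB hf hPhi Lp (L2spec_sstep hf l1))
    (L2specB hf hPhi Lq (L2spec_sstep hf l2)).
  by rewrite invr1 => /le_of_quarters; apply.
have -> : (fun w => Sint (l1 ++ l2) w - (X w + Y w)) =
    (fun w => (Sint l1 w - X w) + (Sint l2 w - Y w)).
  by apply/funext => x; rewrite sint_cat opprD addrACA.
have := nrm2D_le2 (L2rvB (L2rv_sint hPhi l1) LX) (L2rvB (L2rv_sint hPhi l2) LY).
by move/le_of_quarters; apply.
Qed.

Lemma is_stoch_intZ (z : R[i]) phi X : is_stoch_int P f Phi phi X ->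
  is_stoch_int P f Phi (fun x => z *: phi x) (fun w => z * X w).
Proof.
move=> /is_stoch_intP[Lp LX H].
apply/is_stoch_intP; split; [exact: (L2specZ hf)|exact: L2rvZ|].
move=> e e0; have s0 : 0 < 1 + sqmod z by rewrite ltr_pwDl // sqmod_ge0.
have [l [a b]] := H (e / (1 + sqmod z)) (divr_gt0 e0 s0).
have le_e (y : R) : 0 <= y -> y <= e / (1 + sqmod z) -> sqmod z * y <= e.
  move=> y0; rewrite ler_pdivlMr // => ye; apply: le_trans ye.
  by rewrite mulrC ler_wpM2l // lerDr.
exists [seq (p.1, z *: p.2) | p <- l]; split.
  have -> : (fun x => z *: phi x - sstep [seq (p.1, z *: p.2) | p <- l] x) =
      (fun x => z *: (phi x - sstep l x)).
    by apply/funext => x; rewrite sstep_scale scalerBr.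
  rewrite (qnZ hf); last exact: (L2specB hf hPhi Lp (L2spec_sstep hf l)).
  by apply: le_e => //; exact: qn_ge0.
have -> : (fun w => Sint [seq (p.1, z *: p.2) | p <- l] w - z * X w) =
    (fun w => z * (Sint l w - X w)).
  by apply/funext => w; rewrite sint_scale mulrBr.
rewrite nrm2Z; last exact: (L2rvB (L2rv_sint hPhi l) LX).
by apply: le_e => //; exact: nrm2_ge0.
Qed.

Lemma is_stoch_intB phi psi X Y : is_stoch_int P f Phi phi X ->
  is_stoch_int P f Phi psi Y ->
  is_stoch_int P f Phi (fun x => phi x - psi x) (fun w => X w - Y w).
Proof.
move=> H1 /(is_stoch_intZ (-1)) H2.
have := is_stoch_intD H1 H2.
under eq_fun do rewrite scaleN1r.
by under [X in is_stoch_int _ _ _ _ X]eq_fun do rewrite mulN1r.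
Qed.

Lemma is_stoch_int_sstep l : is_stoch_int P f Phi (sstep l) (Sint l).
Proof.
apply/is_stoch_intP; split; [exact: (L2spec_sstep hf)|exact: (L2rv_sint hPhi)|].
move=> e e0; exists l; split.
  under eq_fun do rewrite subrr.
  by rewrite /qn; under eq_fun do rewrite sq0l Normc.normc0; rewrite rint0 ltW.
under eq_fun do rewrite subrr.
by rewrite /nrm2; under eq_fun do rewrite sqmodE /= expr0n addr0; rewrite rint0 ltW.
Qed.

Lemma is_stoch_int_sum (I : Type) (r : seq I) (phi : I -> R -> 'rV[R[i]]_m)
    (X : I -> T -> R[i]) : (forall i, is_stoch_int P f Phi (phi i) (X i)) ->
  is_stoch_int P f Phi (fun x => \sum_(i <- r) phi i x)
    (fun w => \sum_(i <- r) X i w).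
Proof.
move=> H; elim: r => [|i r IH].
  have := is_stoch_int_sstep [::]; rewrite /sstep /sint.
  under eq_fun do rewrite big_nil.
  under [X in is_stoch_int _ _ _ _ X]eq_fun do rewrite big_nil.
  under [X in _ -> is_stoch_int _ _ _ X _]eq_fun do rewrite big_nil.
  by under [X in _ -> is_stoch_int _ _ _ _ X]eq_fun do rewrite big_nil.
under eq_fun do rewrite big_cons.
by under [X in is_stoch_int _ _ _ _ X]eq_fun do rewrite big_cons; exact: is_stoch_intD.
Qed.

Lemma is_stoch_int_ae phi X Y : cmeasurable Y -> ae_eq P setT X Y ->
  is_stoch_int P f Phi phi X -> is_stoch_int P f Phi phi Y.
Proof.
move=> mY XY /is_stoch_intP[Lp LX H]; have LY := L2rv_ae_eq mY XY LX.
apply/is_stoch_intP; split => // e e0; have [l [a b]] := H e e0.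
exists l; split => //; rewrite (@nrm2_ae_eq _ _ _ _ _ (fun w => Sint l w - X w)) //.
- exact: L2rv_cmeasurable (L2rvB (L2rv_sint hPhi l) LY).
- exact: L2rv_cmeasurable (L2rvB (L2rv_sint hPhi l) LX).
by apply: ae_imp XY => w XY Tw; rewrite XY.
Qed.

(** The isometry, applied to differences of step functions, carries the Cauchy property of the
    approximants from L^2(f) to L^2(P), where limits exist. *)
Lemma is_stoch_int_exists phi : L2spec f phi -> exists X, is_stoch_int P f Phi phi X.
Proof.
move=> Lp.
have /choice[l lP] n : exists l, qn f (fun x => phi x - sstep l x) <= n.+1%:R^-1.
  by apply: (sstep_dense hf hPhi Lp); rewrite invr_gt0.
have LS n : L2rv P (Sint (l n)) by exact: (L2rv_sint hPhi).
have Ls n : L2spec f (sstep (l n)) by exact: (L2spec_sstep hf).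
have [|X LX XP] := @L2rv_complete _ _ _ P (fun n => Sint (l n)) LS.
  move=> e e0; have [M MP] := inv_succ_le (divr_gt0 e0 (ltr0n _ 4)).
  exists M => p q Mp Mq.
  rewrite (stoch_isometry (is_stoch_intB (is_stoch_int_sstep (l p)) (is_stoch_int_sstep (l q)))).
  have := qnD_le hf hPhi ltr01 (L2specB hf hPhi (Ls p) Lp) (L2specB hf hPhi Lp (Ls q)).
  rewrite invr1 (_ : (fun x => _ + _) = (fun x => sstep (l p) x - sstep (l q) x)); last first.
    by apply/funext => x; rewrite addrA subrK.
  move/le_of_quarters; apply; first rewrite qnBC.
    exact: le_trans (lP p) (MP p Mp).
  exact: le_trans (lP q) (MP q Mq).
exists X; apply/is_stoch_intP; split => // e e0.
have [M1 H1] := inv_succ_le e0; have [M2 H2] := XP e e0.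
exists (l (maxn M1 M2)); split; last by apply: H2; exact: leq_maxr.
by apply: le_trans (lP _) _; apply: H1; exact: leq_maxl.
Qed.

(** Existence rules out the default value 0 of [stoch_int]. *)
Lemma stoch_intP phi : L2spec f phi -> is_stoch_int P f Phi phi (stoch_int P f Phi phi).
Proof.
by move=> Lp; have [X HX] := is_stoch_int_exists Lp; exact: (xgetPex (fun=> 0) (ex_intro _ X HX)).
Qed.
End StochasticIntegrals.

(** * Density of trigonometric polynomials *)

Section SignIteration.
Context {R : realType}.

(** The Newton-Schulz iteration for the sign. Its fixed points are -1, 0 and 1, with derivative 3/2
    at 0 and 0 at the other two. Being polynomial, it preserves any algebra of functions. *)
Definition sgn_step (y : R) : R := (3 * y - y ^+ 3) / 2.

Lemma sgn_stepN y : sgn_step (- y) = - sgn_step y.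
Proof. by rewrite /sgn_step; field. Qed.

Lemma sgn_step_pos y : 0 < y <= 1 ->
  [/\ y <= sgn_step y, sgn_step y <= 1 & 1 - sgn_step y <= (1 - y / 2) * (1 - y)].
Proof.
move=> /andP[y0 y1]; rewrite /sgn_step; split; rewrite -subr_ge0.
- rewrite (_ : _ - _ = y * (1 - y) * (1 + y) / 2); last by field.
  by rewrite divr_ge0 // !mulr_ge0 ?subr_ge0 ?addr_ge0 ?(ltW y0).
- rewrite (_ : _ - _ = (1 - y) ^+ 2 * (2 + y) / 2); last by field.
  by rewrite divr_ge0 // mulr_ge0 ?sqr_ge0 //; lra.
rewrite (_ : _ - _ = (1 - y) * y ^+ 2 / 2); last by field.
by rewrite divr_ge0 // mulr_ge0 ?sqr_ge0 ?subr_ge0.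
Qed.

(** A step at z shrinks the distance to 1 by the factor 1 - z/2; as the iterates stay above y, this
    factor is at most 1 - y/2. *)
Lemma iter_sgn_pos y n : 0 < y <= 1 ->
  [/\ y <= iter n sgn_step y, iter n sgn_step y <= 1 &
      1 - iter n sgn_step y <= (1 - y / 2) ^+ n].
Proof.
move=> /andP[y0 y1]; elim: n => [|n [h1 h2 h3]] /=.
  by rewrite expr0 lexx; split=> //; rewrite lerBlDr lerDl ltW.
set z := iter n sgn_step y in h1 h2 h3 *.
have z0 : 0 < z := lt_le_trans y0 h1.
have [|k1 k2 k3] := @sgn_step_pos z; first by rewrite z0 h2.
split => //; first exact: le_trans h1 k1.
apply: le_trans k3 _; rewrite exprS; apply: ler_pM => //.
- by rewrite subr_ge0 ler_pdivrMr // mul1r; lra.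
- by rewrite subr_ge0.
by rewrite lerD2l lerN2 ler_pM2r // invr_gt0.
Qed.

Lemma iter_sgnN y n : iter n sgn_step (- y) = - iter n sgn_step y.
Proof. by elim: n => //= n ->; exact: sgn_stepN. Qed.

Lemma iter_sgn0 n : iter n sgn_step 0 = 0.
Proof. by elim: n => //= n ->; rewrite /sgn_step mulr0 expr0n subr0 mul0r. Qed.

Lemma iter_sgn_le1 y n : `|y| <= 1 -> `|iter n sgn_step y| <= 1.
Proof.
have pos z : 0 < z <= 1 -> `|iter n sgn_step z| <= 1.
  move=> z01; have [h1 h2 _] := iter_sgn_pos n z01; rewrite ger0_norm //.
  by have /andP[z0 _] := z01; exact: le_trans (ltW z0) h1.
rewrite ler_norml => /andP[y1 y2]; have [y0|y0|->] := ltgtP y 0.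
- by rewrite -normrN -iter_sgnN pos // oppr_gt0 y0; lra.
- by rewrite pos // y0.
by rewrite iter_sgn0 normr0.
Qed.

Lemma iter_sgn_cvg y : `|y| <= 1 -> (fun n => iter n sgn_step y) @ \oo --> Num.sg y.
Proof.
have pos z : 0 < z <= 1 -> (fun n => iter n sgn_step z) @ \oo --> (1 : R).
  move=> /[dup] z01 /andP[z0 z1].
  have c0 : (fun n => 1 - (1 - z / 2) ^+ n) @ \oo --> (1 : R).
    rewrite -[X in _ --> X]subr0; apply: cvgB; first exact: cvg_cst.
    by apply: cvg_expr; rewrite ger0_norm; lra.
  apply: (@squeeze_cvgr _ _ _ _ (fun n => 1 - (1 - z / 2) ^+ n) (fun=> 1)) => //.
    apply: nearW => n; have [_ h2 h3] := iter_sgn_pos n z01.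
    by rewrite h2 andbT lerBlDr -lerBlDl.
  exact: cvg_cst.
rewrite ler_norml => /andP[y1 y2]; have [y0|y0|->] := ltgtP y 0.
- rewrite ltr0_sg //; have -> : (fun n => iter n sgn_step y) =
      (fun n => - iter n sgn_step (- y)).
    by apply/funext => n; rewrite iter_sgnN opprK.
  by apply: cvgN; apply: pos; rewrite oppr_gt0 y0; lra.
- by rewrite gtr0_sg //; apply: pos; rewrite y0.
by rewrite sgr0; under eq_fun do rewrite iter_sgn0; exact: cvg_cst.
Qed.

(** The sequence is eventually constant: once |y| <= n, the argument lies strictly between -pi and
    pi, where the sine has the sign of its argument. *)
Lemma sg_sin_cvg (y : R) :
  (fun n : nat => Num.sg (sin (y / n.+1%:R))) @ \oo --> Num.sg y.
Proof.
have pos (z : R) (n : nat) : 0 < z -> z <= n%:R -> 0 < sin (z / n.+1%:R).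
  move=> z0 zn; apply: sin_gt0_pi; rewrite divr_gt0 //= ltr_pdivrMr //.
  apply: le_lt_trans zn _; apply: lt_le_trans (_ : n.+1%:R <= _).
    by rewrite ltr_nat.
  by rewrite ler_peMl //; apply: le_trans (pi_ge2 R); rewrite ler1n.
apply: cvg_near_cst; exists (Num.truncn `|y|).+1 => // n /= yn.
have {}yn : `|y| <= n%:R.
  by apply: ltW; apply: lt_le_trans (truncnS_gt _) _; rewrite ler_nat.
have [y0|y0|->] := ltgtP y 0.
- rewrite [RHS]ltr0_sg // ltr0_sg // -oppr_gt0 -sinN -mulNr.
  by apply: pos; rewrite ?oppr_gt0 // -ltr0_norm.
- by rewrite !gtr0_sg //; apply: pos => //; move: yn; rewrite gtr0_norm.
by rewrite mul0r sin0.
Qed.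
End SignIteration.

Section TrigonometricPolynomials.
Context {R : realType}.

(** Frequencies are arbitrary reals because they stand for the times of the process: multiplied by
    the unit row of c, this is the spectral row of the combination of the Y_c(s) with the same
    coefficients. *)
Definition tpoly (p : seq (R[i] * R)) (x : R) : R[i] :=
  \sum_(q <- p) q.1 * expi (x * q.2).

Lemma tpoly_cat p q x : tpoly (p ++ q) x = tpoly p x + tpoly q x.
Proof. by rewrite /tpoly big_cat. Qed.

Lemma tpolyM p q x :
  tpoly [seq (a.1 * b.1, a.2 + b.2) | a <- p, b <- q] x = tpoly p x * tpoly q x.
Proof.
rewrite /tpoly big_allpairs_dep mulr_suml; apply: eq_bigr => a _.
rewrite mulr_sumr; apply: eq_bigr => b _ /=.
by rewrite mulrDr expiD; ring.
Qed.

Lemma cmeasurable_tpoly p : cmeasurable (tpoly p).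
Proof.
apply: cmeasurable_sum => q; apply: cmeasurableM; first exact: cmeasurable_cst.
by apply: cmeasurable_expi; exact: measurable_funM.
Qed.

Lemma tpoly_bounded p : exists K, forall x, sqmod (tpoly p x) <= K.
Proof.
rewrite /tpoly; elim: p => [|q p [K IH]].
  by exists 0 => x; rewrite big_nil sqmodE /= expr0n addr0.
exists (2 * sqmod q.1 + 2 * K) => x; rewrite big_cons.
apply: le_trans (sqmodD_le2 _ _) _.
by rewrite sqmodM sqmod_expi mulr1 lerD2l ler_wpM2l.
Qed.
End TrigonometricPolynomials.

(** * Functions approximable by trigonometric polynomials along a fixed row *)

Section TrigonometricDensity.
Context {R : realType} {m : nat}.
Context {d : measure_display} {T : measurableType d} (P : probability T R).
Variables (f : R -> 'M[R[i]]_m) (Phi : 'I_m -> set R -> T -> R[i]).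
Hypothesis hf : forall a b, cintegrable lebesgue_measure setT (fun x => f x a b).
Hypothesis hPhi : random_orthogonal_measure P f Phi.
Variable v : 'rV[R[i]]_m.
Implicit Types (b c : R -> R[i]) (u : R -> R).

Definition bmeas c : Prop := cmeasurable c /\ exists K, forall x, sqmod (c x) <= K.

Let N c : R := qn f (fun x => c x *: v).

(** Boundedness is built in so that products can be approximated factor by factor. *)
Definition tapprox c : Prop := bmeas c /\
  forall e : R, 0 < e -> exists p, qn f (fun x => (c x - tpoly p x) *: v) <= e.

Lemma bmeas_tpoly p : bmeas (tpoly p).
Proof. by split; [exact: cmeasurable_tpoly|exact: tpoly_bounded]. Qed.

Lemma bmeasD b c : bmeas b -> bmeas c -> bmeas (fun x => b x + c x).
Proof.
move=> [mb [K bK]] [mc [L cL]]; split; first exact: cmeasurableD.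
exists (2 * K + 2 * L) => x; apply: le_trans (sqmodD_le2 _ _) _.
by rewrite lerD // ler_wpM2l.
Qed.

Lemma bmeasM b c : bmeas b -> bmeas c -> bmeas (fun x => b x * c x).
Proof.
move=> [mb [K bK]] [mc [L cL]]; split; first exact: cmeasurableM.
by exists (K * L) => x; rewrite sqmodM ler_pM ?sqmod_ge0.
Qed.

Lemma bmeas_cst z : bmeas (fun=> z).
Proof. by split; [exact: cmeasurable_cst|exists (sqmod z)]. Qed.

Lemma bmeasB b c : bmeas b -> bmeas c -> bmeas (fun x => b x - c x).
Proof.
move=> Hb Hc; under eq_fun do rewrite -mulN1r.
by apply: bmeasD => //; apply: bmeasM => //; exact: bmeas_cst.
Qed.

Lemma L2spec_bmeas c : bmeas c -> L2spec f (fun x => c x *: v).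
Proof.
move=> [mc [K cK]]; apply: (L2specM hf mc cK).
apply: (L2spec_bounded hf (rv_cmeasurable_cst v)) => x j.
exact: normc_le_sum.
Qed.

Lemma qn_bmeasD b c : bmeas b -> bmeas c ->
  qn f (fun x => (b x + c x) *: v) <= (1 + 1) * N b + (1 + 1) * N c.
Proof.
move=> Hb Hc; have := qnD_le hf hPhi ltr01 (L2spec_bmeas Hb) (L2spec_bmeas Hc).
by rewrite invr1; under eq_fun do rewrite -scalerDl.
Qed.

Lemma qn_bmeasM b c K : bmeas b -> bmeas c -> (forall x, sqmod (b x) <= K) ->
  qn f (fun x => (b x * c x) *: v) <= K * N c.
Proof.
move=> Hb Hc bK; have /(L2specP hf)[_ i1] := L2spec_bmeas (bmeasM Hb Hc).
have /(L2specP hf)[_ i2] := L2spec_bmeas Hc.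
rewrite /N /qn -rintZ //; apply: rint_le => //; first exact: rintegrableZ.
by move=> x; rewrite -scalerA normc_sq_scale ler_wpM2r ?normc_ge0.
Qed.

Lemma tapprox_tpoly p : tapprox (tpoly p).
Proof.
split; first exact: bmeas_tpoly; move=> e e0; exists p.
rewrite /qn; under eq_fun do rewrite subrr scale0r sq0l Normc.normc0.
by rewrite rint0 ltW.
Qed.

Lemma tapproxD b c : tapprox b -> tapprox c -> tapprox (fun x => b x + c x).
Proof.
move=> [Hb Ab] [Hc Ac]; split; first exact: bmeasD.
move=> e e0; have e4 : 0 < e / 4 by rewrite divr_gt0.
have [p pP] := Ab _ e4; have [q qP] := Ac _ e4; exists (p ++ q).
have -> : (fun x => (b x + c x - tpoly (p ++ q) x) *: v) =
    (fun x => ((b x - tpoly p x) + (c x - tpoly q x)) *: v).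
  by apply/funext => x; rewrite tpoly_cat opprD addrACA.
apply: le_of_quarters (qn_bmeasD (bmeasB Hb (bmeas_tpoly p))
  (bmeasB Hc (bmeas_tpoly q))) _ _; [exact: pP|exact: qP].
Qed.

Lemma tapproxM b c : tapprox b -> tapprox c -> tapprox (fun x => b x * c x).
Proof.
move=> [Hb Ab] [Hc Ac]; split; first exact: bmeasM.
move=> e e0; have [mb [K bK]] := Hb.
have K0 : 0 <= K by exact: le_trans (sqmod_ge0 _) (bK 0).
(* From bc - pq = b(c - q) + q(b - p): q is chosen before p, since the bound L of q enters the
   precision demanded of p. *)
have [|q qP] := Ac (e / 4 / (K + 1)); first by rewrite !divr_gt0 // ltr_wpDl.
have [L qL] := tpoly_bounded q.
have L0 : 0 <= L by exact: le_trans (sqmod_ge0 _) (qL 0).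
have [|p pP] := Ab (e / 4 / (L + 1)); first by rewrite !divr_gt0 // ltr_wpDl.
exists [seq (a1.1 * a2.1, a1.2 + a2.2) | a1 <- p, a2 <- q].
have -> : (fun x => (b x * c x -
    tpoly [seq (a1.1 * a2.1, a1.2 + a2.2) | a1 <- p, a2 <- q] x) *: v) =
    (fun x => (b x * (c x - tpoly q x) + tpoly q x * (b x - tpoly p x)) *: v).
  by apply/funext => x; rewrite tpolyM; congr (_ *: _); ring.
have H1 := bmeasB Hc (bmeas_tpoly q); have H2 := bmeasB Hb (bmeas_tpoly p).
apply: le_of_quarters (qn_bmeasD (bmeasM Hb H1) (bmeasM (bmeas_tpoly q) H2)) _ _.
  apply: le_trans (qn_bmeasM Hb H1 bK) _.
  exact: (scaled_quarter K0 (qn_ge0 _ _) qP).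
apply: le_trans (qn_bmeasM (bmeas_tpoly q) H2 qL) _.
exact: (scaled_quarter L0 (qn_ge0 _ _) pP).
Qed.

Lemma tapprox_cst z : tapprox (fun=> z).
Proof.
have -> : (fun=> z) = tpoly [:: (z, 0)] :> (R -> R[i]).
  apply/funext => x; rewrite /tpoly big_seq1 /= mulr0.
  by apply: complexP; rewrite ?ReM ?ImM /= cos0 sin0; ring.
exact: tapprox_tpoly.
Qed.

Definition tapproxR u : Prop := tapprox (fun x => real_complex R (u x)).

Lemma tapproxRD u w : tapproxR u -> tapproxR w -> tapproxR (fun x => u x + w x).
Proof.
move=> Hu Hw; rewrite /tapproxR; under eq_fun do rewrite rmorphD.
exact: (tapproxD Hu Hw).
Qed.

Lemma tapproxRM u w : tapproxR u -> tapproxR w -> tapproxR (fun x => u x * w x).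
Proof.
move=> Hu Hw; rewrite /tapproxR; under eq_fun do rewrite rmorphM.
exact: (tapproxM Hu Hw).
Qed.

Lemma tapproxR_cst (a : R) : tapproxR (fun=> a).
Proof. exact: tapprox_cst. Qed.

(** Dominated convergence: the differences are at most 2K, and the form of the constant row v is
    integrable. *)
Lemma tapproxR_lim (u_ : nat -> R -> R) u (K : R) : (forall n, tapproxR (u_ n)) ->
  (forall n x, `|u_ n x| <= K) -> (forall x, u_ ^~ x @ \oo --> u x) -> tapproxR u.
Proof.
move=> A uK cu.
have uxK x : `|u x| <= K.
  by apply: (cvgr_to_le (cvg_norm (cu x))); exact: nearW.
have mu_ n : measurable_fun setT (u_ n) by have [[[]]] := A n.
have mu : measurable_fun setT u by apply: (measurable_fun_cvg mu_) => x _; exact: cu.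
have sqR (a : R) : sqmod (real_complex R a) = a ^+ 2 by rewrite sqmodE /= expr0n addr0.
have bu : bmeas (fun x => real_complex R (u x)).
  split; first exact: cmeasurable_real.
  by exists (K ^+ 2) => x; rewrite sqR -real_normK ?num_real // !expr2 ler_pM.
split=> // e e0; have e4 : 0 < e / 4 by rewrite divr_gt0.
have L1 := L2spec_bmeas (bmeas_cst 1); have /(L2specP hf)[_ i1] := L1.
have : (fun n => qn f (fun x => (real_complex R (u x) - real_complex R (u_ n x)) *: v))
    @ \oo --> 0.
  apply: (@rint_dominated_cvg0 _ _ _ lebesgue_measure
   (fun n x => Normc.normc (sq (f x)
      ((real_complex R (u x) - real_complex R (u_ n x)) *: v)
      ((real_complex R (u x) - real_complex R (u_ n x)) *: v)))
   (fun x => (K + K) ^+ 2 * Normc.normc (sq (f x) (1 *: v) (1 *: v)))).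
  - move=> n; have [bn _] := A n.
    have /(L2specP hf)[mD _] := L2spec_bmeas (bmeasB bu bn).
    exact: (measurable_normc_sq hf mD).
  - exact: rintegrableZ.
  - move=> n x; rewrite ger0_norm ?normc_ge0 // normc_sq_scale scale1r.
    rewrite ler_wpM2r ?normc_ge0 // -rmorphB sqR -real_normK ?num_real //.
    rewrite !expr2 ler_pM //; apply: le_trans (ler_normB _ _) _;
    by apply: lerD.
  move=> x; under eq_fun do rewrite normc_sq_scale -rmorphB sqR.
  rewrite (_ : 0 = (u x - u x) * (u x - u x) * Normc.normc (sq (f x) v v)); last first.
    by rewrite subrr !mul0r.
  apply: cvgM; last exact: cvg_cst.
  by apply: cvgM; apply: cvgB => //; exact: cvg_cst.
move=> /cvgrPdist_le/(_ _ e4)[n _ /(_ n (leqnn n))].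
rewrite sub0r normrN ger0_norm ?qn_ge0 // => Hn.
have [bn An] := A n; have [p pP] := An _ e4; exists p.
have -> : (fun x => (real_complex R (u x) - tpoly p x) *: v) =
    (fun x => ((real_complex R (u x) - real_complex R (u_ n x)) +
               (real_complex R (u_ n x) - tpoly p x)) *: v).
  by apply/funext => x; rewrite addrA subrK.
apply: le_of_quarters (qn_bmeasD (bmeasB bu bn) (bmeasB bn (bmeas_tpoly p))) _ _.
  exact: Hn.
exact: pP.
Qed.

Lemma tapproxR_sin (h a : R) : tapproxR (fun x => sin ((x - a) * h)).
Proof.
(* The sine is (e^(iy) - e^(-iy))/(2i) with y = (x - a)h; z is 1/(2i) times the phase of the shift
   by a. *)
pose z := Complex 0 (- 2^-1) * expi (- (a * h)).
rewrite /tapproxR (_ : (fun x => _) = tpoly [:: (z, h); (z^*, - h)]); last first.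
  apply/funext => x; rewrite /tpoly big_cons big_seq1 /=.
  have E : expi (x * - h) = (expi (x * h))^*.
    by apply: complexP; rewrite ?ReC ?ImC /= mulrN ?cosN ?sinN.
  rewrite E -rmorphM /z -mulrA -expiD [- _ + _]addrC -mulrBl.
  by apply: complexP; rewrite ?ReD ?ImD ?ReC ?ImC ?ReM ?ImM /=; field.
exact: tapprox_tpoly.
Qed.

Lemma tapproxR_sg u : tapproxR u -> (forall x, `|u x| <= 1) ->
  tapproxR (fun x => Num.sg (u x)).
Proof.
move=> Au u1.
apply: (@tapproxR_lim (fun n x => iter n sgn_step (u x)) _ 1).
- elim=> [|n IH]; first exact: Au.
  rewrite /= /sgn_step.
  have -> : (fun x => (3 * iter n sgn_step (u x) - iter n sgn_step (u x) ^+ 3) / 2) =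
     (fun x => 3 / 2 * iter n sgn_step (u x) + - 2^-1 *
       (iter n sgn_step (u x) * (iter n sgn_step (u x) * iter n sgn_step (u x)))).
    by apply/funext => x; rewrite !exprS expr0 mulr1; field.
  exact: (tapproxRD (tapproxRM (tapproxR_cst _) IH)
    (tapproxRM (tapproxR_cst _) (tapproxRM IH (tapproxRM IH IH)))).
- by move=> n x; exact: iter_sgn_le1.
by move=> x; exact: iter_sgn_cvg.
Qed.

Lemma tapproxR_ray (a : R) : tapproxR (\1_(`]a, +oo[%classic)).
Proof.
have A : tapproxR (fun x => Num.sg (x - a)).
  apply: (@tapproxR_lim (fun n x => Num.sg (sin ((x - a) / n.+1%:R))) _ 1).
  - move=> n; apply: tapproxR_sg; first exact: tapproxR_sin.
    by move=> x; rewrite ler_norml sin_geN1 sin_le1.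
  - by move=> n x; rewrite normr_sg; case: (_ != 0).
  by move=> x; exact: sg_sin_cvg.
(* (s^2 + s)/2 takes the values 0, 0, 1 at s = -1, 0, 1, so the endpoint a is excluded, as in the
   generating open rays. *)
have -> : \1_(`]a, +oo[%classic) = (fun x => 2^-1 *
    (Num.sg (x - a) * Num.sg (x - a) + Num.sg (x - a))) :> (R -> R).
  apply/funext => x; rewrite indicE; have [xa|xa|->] := ltgtP x a.
  - by rewrite memNset ?ltr0_sg ?subr_lt0 //= ?in_itv /= ?andbT; [ring|lra].
  - by rewrite mem_set ?gtr0_sg ?subr_gt0 //= ?in_itv /= ?andbT //; field.
  by rewrite memNset /= ?in_itv /= ?ltxx // subrr sgr0; ring.
exact: (tapproxRM (tapproxR_cst _) (tapproxRD (tapproxRM A A) A)).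
Qed.

(** Closure under products and bounded limits makes the good sets a sigma-algebra outright, so no
    monotone class argument is called for: containing the rays suffices. *)
Lemma tapproxR_indic (B : set R) : measurable B -> tapproxR (\1_B).
Proof.
pose S := [set B : set R | tapproxR (\1_B)].
suff H : @measurable _ (measurableTypeR R) `<=` S by exact: H.
rewrite RGenOInfty.measurableE; apply: smallest_sub; last first.
  by move=> _ [a ->]; exact: tapproxR_ray.
have SC A : S A -> S (~` A).
  rewrite /S /= => SA; rewrite (_ : \1_(~` A) = (fun x => 1 + -1 * \1_A x)); last first.
    apply/funext => x; rewrite !indicE in_setC; case: (x \in A) => /=; ring.
  exact: (tapproxRD (tapproxR_cst 1) (tapproxRM (tapproxR_cst (-1)) SA)).
split.
- by rewrite /S /= indic0; exact: tapproxR_cst.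
- by move=> A SA; rewrite setTD; exact: SC.
(* Unions are handled through their complements, whose indicators are limits of finite products. *)
move=> A SA; have SP n : tapproxR (fun x => \prod_(i < n) \1_(~` A i) x).
  elim: n => [|n IH].
    by under eq_fun do rewrite big_ord0; exact: tapproxR_cst.
  under eq_fun do rewrite big_ord_recr /=; exact: (tapproxRM IH (SC _ (SA n))).
suff : S (~` \bigcup_k A k) by move/SC; rewrite setCK.
apply: (tapproxR_lim SP (K := 1)).
  move=> n x; elim: n => [|n IH]; first by rewrite big_ord0 normr1.
  rewrite big_ord_recr normrM mulr_ile1 //= indicE.
  by case: (x \in _); rewrite ?normr1 ?normr0.
(* If x lies in [A k], factor k annihilates every product of more than k factors; otherwise all
   factors are 1. *)
move=> x; apply: cvg_near_cst; have [[k _ Ak]|nA] := pselect ((\bigcup_k A k) x).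
  exists k.+1 => // n /= kn; rewrite [RHS]indicE memNset; last by apply; exists k.
  by rewrite (bigD1 (Ordinal kn)) //= indicE memNset ?mul0r //.
apply: nearW => n; rewrite [RHS]indicE mem_set // big1 // => i _.
by rewrite indicE mem_set // => Ai; apply: nA; exists i.
Qed.
End TrigonometricDensity.

(** * Orthogonal projections *)

Section Projections.
Context {R : realType} {d : measure_display} {T : measurableType d}.
Variable P : probability T R.
Implicit Types (X Y Z W : T -> R[i]) (L : set (T -> R[i])).

Record linear_subspace L : Prop := {
  subspace_L2 : forall X, L X -> L2rv P X ;
  subspace0 : L (fun=> 0) ;
  subspaceDZ : forall (z : R[i]) X Y, L X -> L Y -> L (fun w => z * X w + Y w) }.

Lemma subspaceB L X Y : linear_subspace L -> L X -> L Y -> L (fun w => X w - Y w).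
Proof.
move=> HL LX LY; under eq_fun do rewrite addrC -mulN1r.
exact: (subspaceDZ HL).
Qed.

Lemma subspace_sum L (I : Type) (r : seq I) (z : I -> R[i]) (X : I -> T -> R[i]) :
  linear_subspace L -> (forall i, L (X i)) -> L (fun w => \sum_(i <- r) z i * X i w).
Proof.
move=> HL LX; elim: r => [|i r IH].
  by under eq_fun do rewrite big_nil; exact: subspace0 HL.
by under eq_fun do rewrite big_cons; exact: (subspaceDZ HL).
Qed.

Lemma ms_closureP L X : linear_subspace L -> ms_closure P L X <->
  L2rv P X /\ forall e : R, 0 < e ->
    exists2 Z, L Z & nrm2 P (fun w => X w - Z w) <= e.
Proof.
move=> HL; split=> -[LX H]; split=> // e e0.
  have [Z LZ dXZ] := H e e0; exists Z => //.
  by move: dXZ; rewrite (ms_distE LX (subspace_L2 HL LZ)) lte_fin; exact: ltW.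
have [Z LZ dXZ] := H (e / 2) (divr_gt0 e0 (ltr0n _ 2)); exists Z => //.
rewrite (ms_distE LX (subspace_L2 HL LZ)) lte_fin; apply: le_lt_trans dXZ _.
by rewrite ltr_pdivrMr // ltr_pMr // ltr1n.
Qed.

Lemma ms_closure_subspace L : linear_subspace L -> linear_subspace (ms_closure P L).
Proof.
move=> HL; split.
- by move=> X [].
- apply/(ms_closureP _ HL); split; first exact: L2rv0.
  move=> e e0; exists (fun=> 0); first exact: subspace0 HL.
  rewrite /nrm2; under eq_fun do rewrite subrr sqmodE /= expr0n addr0.
  by rewrite rint0 ltW.
move=> z X Y /(ms_closureP _ HL)[LX HX] /(ms_closureP _ HL)[LY HY].
apply/(ms_closureP _ HL); split; first exact: (L2rvD (L2rvZ z LX) LY).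
move=> e e0; have e4 : 0 < e / 4 by rewrite divr_gt0.
have s0 : 0 < sqmod z + 1 by rewrite ltr_wpDl // sqmod_ge0.
have [X' LX' dX] := HX _ (divr_gt0 e4 s0); have [Y' LY' dY] := HY _ e4.
exists (fun w => z * X' w + Y' w); first exact: (subspaceDZ HL).
have -> : (fun w => z * X w + Y w - (z * X' w + Y' w)) =
    (fun w => z * (X w - X' w) + (Y w - Y' w)).
  by apply/funext => w; ring.
have LXX := L2rvB LX (subspace_L2 HL LX'); have LYY := L2rvB LY (subspace_L2 HL LY').
apply: le_of_quarters (nrm2D_le2 (L2rvZ z LXX) LYY) _ dY.
rewrite nrm2Z //; exact: (scaled_quarter (sqmod_ge0 _) (nrm2_ge0 _ _) dX).
Qed.

Lemma ms_closure_lim L X : linear_subspace L -> L2rv P X ->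
  (forall e : R, 0 < e ->
    exists2 Y, ms_closure P L Y & nrm2 P (fun w => X w - Y w) <= e) ->
  ms_closure P L X.
Proof.
move=> HL LX H; apply/(ms_closureP _ HL); split=> // e e0.
have e4 : 0 < e / 4 by rewrite divr_gt0.
have [Y /(ms_closureP _ HL)[LY HY] dXY] := H _ e4.
have [Z LZ dYZ] := HY _ e4; exists Z => //.
have -> : (fun w => X w - Z w) = (fun w => (X w - Y w) + (Y w - Z w)).
  by apply/funext => w; rewrite addrA subrK.
exact: (le_of_quarters (nrm2D_le2 (L2rvB LX LY) (L2rvB LY (subspace_L2 HL LZ))) dXY dYZ).
Qed.

(** Expansion of 0 <= t |X - Y/t|^2; the free weight t does the work of Cauchy-Schwarz. *)
Lemma Re_inner_le X Y (t : R) : 0 < t -> L2rv P X -> L2rv P Y ->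
  2 * complex.Re (inner P X Y) <= t * nrm2 P X + t^-1 * nrm2 P Y.
Proof.
move=> t0 LX LY; set z := real_complex R (- t^-1).
have := nrm2_ge0 P (fun w => X w + z * Y w).
rewrite (nrm2D LX (L2rvZ z LY)) (innerZr z LY LX) (nrm2Z z LY) conj_real ReM /= mul0r subr0.
rewrite sqmodE /= expr0n addr0 sqrrN => /(mulr_ge0 (ltW t0)) H.
rewrite -subr_ge0; apply: le_trans H _; rewrite le_eqVlt; apply/orP; left.
by apply/eqP; field; exact: lt0r_neq0.
Qed.

(** Continuity of the inner product. With z = <X, W> and Z in L close to W, testing X against z(W -
    Z) gives |z|^2, which is real, so a bound on real parts is enough. *)
Lemma inner0_closure L X W : linear_subspace L -> L2rv P X ->
  (forall Z, L Z -> inner P X Z = 0) -> ms_closure P L W -> inner P X W = 0.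
Proof.
move=> HL LX X0 /(ms_closureP _ HL)[LW HW].
set z := inner P X W; apply: sqmod_eq0; apply/eqP; rewrite eq_le sqmod_ge0 andbT.
have N0 := nrm2_ge0 P X.
have c0 : 0 < nrm2 P X + 1 by rewrite ltr_wpDl.
(* Z is taken within t^2/(|z|^2 + 1) of W in squared distance, so that the second term of
   [Re_inner_le] is at most t. *)
have H t : 0 < t -> 2 * sqmod z <= t * (nrm2 P X + 1).
  move=> t0; have s1 : 0 < sqmod z + 1 by rewrite ltr_wpDl // sqmod_ge0.
  have [|Z LZ dZ] := HW (t ^+ 2 / (sqmod z + 1)).
    by rewrite divr_gt0 // exprn_gt0.
  have LZ2 := subspace_L2 HL LZ; have LWZ := L2rvB LW LZ2.
  have -> : sqmod z = complex.Re (inner P X (fun w => z * (W w - Z w))).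
    rewrite (innerZr z LWZ LX).
    have -> : inner P X (fun w => W w - Z w) = z.
      by rewrite (innerJ LWZ LX) (innerBl LW LZ2 LX) rmorphB /= -(innerJ LW LX) -(innerJ LZ2 LX) (X0 Z LZ) subr0.
    by rewrite mulrC mulcJ.
  apply: le_trans (Re_inner_le t0 LX (L2rvZ z LWZ)) _.
  rewrite mulrDr mulr1 lerD2l (nrm2Z z LWZ) mulrC ler_pdivrMr // -expr2.
  move: dZ; rewrite ler_pdivlMr // => dZ; apply: le_trans dZ.
  by rewrite mulrC ler_wpM2l ?nrm2_ge0 // lerDl.
(* The choice t = |z|^2/(|X|^2 + 1) would give 2|z|^2 <= |z|^2. *)
rewrite leNgt; apply/negP => s0.
have := H (sqmod z / (nrm2 P X + 1)) (divr_gt0 s0 c0).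
by rewrite divfK ?lt0r_neq0 // -[leRHS]mul1r ler_pM2r // lern1.
Qed.

Lemma orth_projP L X Z : is_orth_proj P L X Z -> is_orth_proj P L X (orth_proj P L X).
Proof. by move=> H; exact: (xgetPex (fun=> 0) (ex_intro _ Z H)). Qed.

(** Z - Z' = (X - Z') - (X - Z) lies in L and is a difference of two vectors orthogonal to L, hence
    is orthogonal to itself. *)
Lemma is_orth_proj_unique L X Z Z' : linear_subspace L -> L2rv P X ->
  is_orth_proj P L X Z -> is_orth_proj P L X Z' -> ae_eq P setT Z Z'.
Proof.
move=> HL LX [LZ oZ] [LZ' oZ'].
have LZ2 := subspace_L2 HL LZ; have LZ'2 := subspace_L2 HL LZ'.
apply: nrm2_eq0 => //; have LB := subspaceB HL LZ LZ'.
have := inner_nrm2 (L2rvB LZ2 LZ'2).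
have -> : inner P (fun w => Z w - Z' w) (fun w => Z w - Z' w) =
    inner P (fun w => (X w - Z' w) - (X w - Z w)) (fun w => Z w - Z' w).
  by congr inner; apply/funext => w; ring.
rewrite (innerBl (L2rvB LX LZ'2) (L2rvB LX LZ2) (L2rvB LZ2 LZ'2)) oZ // oZ' // subrr.
by case.
Qed.

(** The componentwise projections solve the vector problem. Testing any solution V with W = V - Z
    gives a vanishing sum of the nonnegative |V_j - Z_j|^2, so each term vanishes. *)
Lemma vec_orth_proj_ae n L (X : 'I_n -> T -> R[i]) (Z : 'I_n -> T -> R[i]) i :
  linear_subspace L -> (forall i, L2rv P (X i)) ->
  (forall i, is_orth_proj P L (X i) (Z i)) ->
  ae_eq P setT (vec_orth_proj P L X i) (Z i).
Proof.
move=> HL LX pZ.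
have vZ : is_vec_orth_proj P L X Z.
  split=> [j|W LW]; first by have [] := pZ j.
  by rewrite big1 // => j _; have [_] := pZ j; apply.
have := xgetPex (fun=> fun=> 0) (ex_intro _ Z vZ).
rewrite -/(vec_orth_proj P L X); set V := vec_orth_proj P L X => -[LV oV].
have LZ j : L (Z j) by have [] := pZ j.
have LZ2 j := subspace_L2 HL (LZ j); have LV2 j := subspace_L2 HL (LV j).
pose W j w := V j w - Z j w.
have LW j : L (W j) by exact: (subspaceB HL).
have LW2 j := subspace_L2 HL (LW j).
have : \sum_j real_complex R (nrm2 P (W j)) = 0.
  have := oV W LW; rewrite (eq_bigr (fun j => - real_complex R (nrm2 P (W j)))).
    by rewrite sumrN => /eqP; rewrite oppr_eq0 => /eqP.
  move=> j _; rewrite -(inner_nrm2 (LW2 j)).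
  have -> : (fun w => X j w - V j w) = (fun w => (X j w - Z j w) - W j w).
    by apply/funext => w; rewrite /W; ring.
  rewrite (innerBl (L2rvB (LX j) (LZ2 j)) (LW2 j) (LW2 j)).
  by have [_ ->] := pZ j; rewrite ?sub0r.
rewrite -rmorph_sum /= => -[] /eqP; rewrite psumr_eq0; last by move=> j _; exact: nrm2_ge0.
move=> /allP/(_ i (mem_index_enum _))/= /eqP.
exact: (nrm2_eq0 (LV2 i) (LZ2 i)).
Qed.
End Projections.

(** * Restriction to a set of components *)

Section Restriction.
Context {R : realType} {k : nat}.
Variable C : {set 'I_k}.
Implicit Types (u w : 'rV[R[i]]_#|C|).

(** Extension by zero outside [C]. It carries the form of the block f_CC to that of f, so that the
    row e_a and rows over [C] can be paired. *)
Definition emb u : 'rV[R[i]]_k := \sum_i u 0 i *: delta_mx 0 (enum_val i).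

Lemma embD u w : emb (u + w) = emb u + emb w.
Proof. by rewrite /emb -big_split; apply: eq_bigr => i _; rewrite mxE scalerDl. Qed.

Lemma embZ (z : R[i]) u : emb (z *: u) = z *: emb u.
Proof. by rewrite /emb scaler_sumr; apply: eq_bigr => i _; rewrite mxE scalerA. Qed.

Lemma embB u w : emb (u - w) = emb u - emb w.
Proof. by rewrite embD -scaleN1r embZ scaleN1r. Qed.

Lemma emb_sum (I : Type) (r : seq I) (h : I -> 'rV[R[i]]_#|C|) :
  emb (\sum_(i <- r) h i) = \sum_(i <- r) emb (h i).
Proof.
elim: r => [|i r IH]; last by rewrite !big_cons embD IH.
by rewrite !big_nil -(scale0r 0) embZ scale0r.
Qed.

Lemma emb_delta i : emb (delta_mx 0 i) = delta_mx 0 (enum_val i).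
Proof.
rewrite /emb (bigD1 i) //= big1 ?addr0 ?mxE ?eqxx ?scale1r // => j ji.
by rewrite mxE (negbTE ji) andbF scale0r.
Qed.

Lemma sq_emb (f : R -> 'M[R[i]]_k) x u w :
  sq (f x) (emb u) (emb w) = sq (fsub f C C x) u w.
Proof.
rewrite /emb sq_suml sqE; apply: eq_bigr => i _; rewrite sq_sumr.
by apply: eq_bigr => j _; rewrite sqZl sqZr sq_delta mxE mulrA.
Qed.

Lemma rv_cmeasurable_emb (phi : R -> 'rV[R[i]]_#|C|) :
  rv_cmeasurable phi -> rv_cmeasurable (fun x => emb (phi x)).
Proof.
move=> mphi j; under eq_fun do rewrite /emb summxE.
apply: cmeasurable_sum => i; under eq_fun do rewrite mxE.
by apply: cmeasurableM => //; exact: cmeasurable_cst.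
Qed.

Context {d : measure_display} {T : measurableType d} (P : probability T R).
Variables (f : R -> 'M[R[i]]_k) (Phi : 'I_k -> set R -> T -> R[i]).
Hypothesis hf : forall a b, cintegrable lebesgue_measure setT (fun x => f x a b).
Hypothesis hPhi : random_orthogonal_measure P f Phi.

Lemma cintegrable_fsub a b :
  cintegrable lebesgue_measure setT (fun x => fsub f C C x a b).
Proof. by under eq_fun do rewrite mxE; exact: hf. Qed.

Lemma random_orthogonal_measure_sub :
  random_orthogonal_measure P (fsub f C C) (Phisub Phi C).
Proof.
split.
- by move=> a B mB; exact: (rom_L2 hPhi).
- by move=> a B mB; exact: (rom_mean hPhi).
- move=> a b B B' mB mB'; under eq_fun do rewrite mxE.
  exact: (rom_cov hPhi (enum_val a) (enum_val b) mB mB').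
by move=> a B mB tB; exact: (rom_sigma_additive hPhi (enum_val a) mB tB).
Qed.

Lemma sstep_emb (l : seq (mset * 'rV[R[i]]_#|C|)) x :
  sstep [seq (p.1, emb p.2) | p <- l] x = emb (sstep l x).
Proof.
by rewrite /sstep big_map emb_sum; apply: eq_bigr => p _; rewrite embZ.
Qed.

Lemma sint_emb (l : seq (mset * 'rV[R[i]]_#|C|)) :
  sint Phi [seq (p.1, emb p.2) | p <- l] = sint (Phisub Phi C) l.
Proof.
apply/funext => w; rewrite /sint big_map; apply: eq_bigr => p _ /=.
rewrite /emb; under eq_bigr do rewrite summxE mulr_suml.
rewrite exchange_big; apply: eq_bigr => i _ /=.
rewrite (bigD1 (enum_val i)) //= big1 ?addr0 => [|j ji].
  by rewrite !mxE !eqxx mulr1.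
by rewrite !mxE (negbTE ji) andbF mulr0 mul0r.
Qed.

Lemma qn_emb (phi : R -> 'rV[R[i]]_#|C|) :
  qn f (fun x => emb (phi x)) = qn (fsub f C C) phi.
Proof. by rewrite /qn; under eq_fun do rewrite sq_emb. Qed.

Lemma L2spec_emb (phi : R -> 'rV[R[i]]_#|C|) :
  L2spec (fsub f C C) phi -> L2spec f (fun x => emb (phi x)).
Proof.
move=> /(L2specP cintegrable_fsub)[mphi iphi]; apply/(L2specP hf); split.
  exact: rv_cmeasurable_emb.
by under eq_fun do rewrite sq_emb.
Qed.

Lemma is_stoch_int_emb (phi : R -> 'rV[R[i]]_#|C|) X :
  is_stoch_int P (fsub f C C) (Phisub Phi C) phi X ->
  is_stoch_int P f Phi (fun x => emb (phi x)) X.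
Proof.
move=> /(is_stoch_intP cintegrable_fsub random_orthogonal_measure_sub)[Lphi LX H].
apply/(is_stoch_intP hf hPhi); split; [exact: L2spec_emb|exact: LX|].
move=> e e0; have [l [l1 l2]] := H e e0.
exists [seq (p.1, emb p.2) | p <- l]; split; last by rewrite sint_emb.
under eq_fun do rewrite sstep_emb -embB.
by rewrite qn_emb.
Qed.
End Restriction.

(** * Measurability of the inverse matrix *)

Section MatrixMeasurability.
Context {d : measure_display} {T : measurableType d} {R : realType}.

Lemma cmeasurable_det n (M : T -> 'M[R[i]]_n) :
  (forall i j, cmeasurable (fun x => M x i j)) -> cmeasurable (fun x => \det (M x)).
Proof.
move=> mM; apply: cmeasurable_sum => s; apply: cmeasurableM.
  exact: cmeasurable_cst.
exact: cmeasurable_prod.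
Qed.

(** By Cramer's rule the entries are cofactors divided by the determinant. *)
Lemma cmeasurable_invmx n (M : T -> 'M[R[i]]_n) i j :
  (forall i j, cmeasurable (fun x => M x i j)) -> (forall x, M x \in unitmx) ->
  cmeasurable (fun x => invmx (M x) i j).
Proof.
move=> mM uM; under eq_fun do rewrite /invmx uM mxE.
apply: cmeasurableM; first by apply: cmeasurableV; exact: cmeasurable_det.
under eq_fun do rewrite mxE /cofactor.
apply: cmeasurableM; first exact: cmeasurable_cst.
by apply: cmeasurable_det => a b; under eq_fun do rewrite !mxE; exact: mM.
Qed.

Lemma posdefmx_unit n (M : 'M[R[i]]_n) : posdefmx M -> M \in unitmx.
Proof.
move=> [_ pM]; rewrite -row_free_unit -kermx_eq0; apply/negPn/negP => K0.
have := pM (nz_row (kermx M)); rewrite nz_row_eq0 => /(_ K0).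
have /sub_kermxP -> : (nz_row (kermx M) <= kermx M)%MS by exact: nz_row_sub.
by rewrite mul0mx mxE ltxx.
Qed.
End MatrixMeasurability.

(** * The spectral projection *)

Section SpectralProjection.
Context {R : realType} {d : measure_display} {T : measurableType d}.
Variables (P : probability T R) (k : nat) (Y : 'I_k -> R -> {RV P >-> R}).
Variables (f : R -> 'M[R[i]]_k) (Phi : 'I_k -> set R -> T -> R[i]).
Hypothesis hf : forall a b, cintegrable lebesgue_measure setT (fun x => f x a b).
Hypothesis hPhi : random_orthogonal_measure P f Phi.
Hypothesis hYPhi : spectral_representation Y f Phi.
Local Open Scope sesquilinear_scope.

Lemma cmeasurable_expiM (s : R) : cmeasurable (fun x : R => expi (x * s)).
Proof. by apply: cmeasurable_expi; exact: measurable_funM. Qed.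

Lemma L2spec_delta a : L2spec f (fun=> delta_mx 0 a).
Proof.
apply: (L2spec_bounded hf (rv_cmeasurable_cst _)) => x j; exact: normc_le_sum.
Qed.

(** The spectral representation identifies Y_a(t) with a chosen version of the integral up to a null
    set; as Y_a(t) is measurable, it is itself a version. *)
Lemma Yc_stoch_int a t :
  is_stoch_int P f Phi (fun x => expi (x * t) *: delta_mx 0 a) (Yc Y a t).
Proof.
have L : L2spec f (fun x => expi (x * t) *: delta_mx 0 a).
  apply: (L2specM hf (cmeasurable_expiM t) (K := 1)); last exact: L2spec_delta.
  by move=> x; rewrite sqmod_expi.
have mY : cmeasurable (Yc Y a t) by apply: cmeasurable_real.
have := stoch_intP hf hPhi L; apply: (is_stoch_int_ae hf hPhi mY).
apply: ae_eq_sym; have := hYPhi a t.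
suff -> : (fun l : R => row a (expi (l * t))%:M) = (fun x => expi (x * t) *: delta_mx 0 a) by [].
by apply/funext => x; apply/rowP => j; rewrite !mxE eqxx /= eq_sym mulr_natr.
Qed.

Lemma L2rv_Yc a t : L2rv P (Yc Y a t).
Proof. by have [_ H _] := Yc_stoch_int a t. Qed.

Lemma cspan_subspace (C : {set 'I_k}) : linear_subspace P (cspan Y C).
Proof.
split.
- move=> _ [n [z [c [s [_ ->]]]]]; apply: L2rv_sum => i; apply: L2rvZ; exact: L2rv_Yc.
(* [C], or even ['I_k], may be empty, so the index functions of the empty combination are built from
   absurdity. *)
- have F : 'I_0 -> False by case.
  exists 0%N, (fun i => False_rect _ (F i)), (fun i => False_rect _ (F i)),
    (fun i => False_rect _ (F i)); split; first by case.
  by apply/funext => w; rewrite big_ord0.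
move=> a _ _ [n [z [c [s [cC ->]]]]] [n' [z' [c' [s' [cC' ->]]]]].
exists (n + n')%N, (fun i => match fintype.split i with inl j => a * z j | inr j => z' j end),
  (fun i => match fintype.split i with inl j => c j | inr j => c' j end),
  (fun i => match fintype.split i with inl j => s j | inr j => s' j end); split.
  by move=> i; case: (fintype.split i).
apply/funext => w; rewrite big_split_ord mulr_sumr /=; congr (_ + _).
  apply: eq_bigr => i _; have := unsplitK (inl i : 'I_n + 'I_n').
  by rewrite /= => ->; rewrite mulrA.
by apply: eq_bigr => i _; have := unsplitK (inr i : 'I_n + 'I_n') => /= ->.
Qed.

Lemma linspace_subspace (C : {set 'I_k}) : linear_subspace P (linspace Y C).
Proof. exact: (ms_closure_subspace (cspan_subspace C)). Qed.

Lemma cspan_Yc (C : {set 'I_k}) c s : c \in C -> cspan Y C (Yc Y c s).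
Proof.
move=> cC; exists 1%N, (fun=> 1), (fun=> c), (fun=> s); split => //.
by apply/funext => w; rewrite big_ord1 mul1r.
Qed.

(* Indicator functions are limits of trigonometric polynomials in L^2(f_cc). *)
Lemma linspace_Phi (C : {set 'I_k}) c (B : set R) : c \in C -> measurable B ->
  linspace Y C (Phi c B).
Proof.
move=> cC mB; have HS := cspan_subspace C.
apply/(ms_closureP _ HS); split; first exact: (rom_L2 hPhi).
move=> e e0; have [_ A] := tapproxR_indic hf hPhi (delta_mx 0 c) mB.
have [p pP] := A e e0; exists (fun w => \sum_(q <- p) q.1 * Yc Y c q.2 w).
  by apply: (subspace_sum _ _ HS) => q; exact: cspan_Yc.
(* Both [Phi c B] and the combination of the process are integrals of multiples of the unit row of
   c, so the isometry turns their distance into the error controlled by [pP]. *)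
have S1 : is_stoch_int P f Phi (fun x => real_complex R (\1_B x) *: delta_mx 0 c) (Phi c B).
  have := is_stoch_int_sstep hf hPhi [:: ((exist _ B mB : mset), delta_mx 0 c : 'rV_k)].
  have -> : sstep [:: ((exist _ B mB : mset), delta_mx 0 c : 'rV_k)] =
      (fun x => real_complex R (\1_B x) *: delta_mx 0 c).
    by apply/funext => x; rewrite /sstep big_seq1.
  suff -> : sint Phi [:: ((exist _ B mB : mset), delta_mx 0 c : 'rV_k)] = Phi c B by [].
  apply/funext => w; rewrite /sint big_seq1 /= (bigD1 c) //= big1 ?addr0 => [|j jc].
    by rewrite mxE !eqxx mul1r.
  by rewrite mxE (negbTE jc) andbF mul0r.
have S2 := is_stoch_int_sum hf hPhi p (fun q => is_stoch_intZ hf hPhi q.1 (Yc_stoch_int c q.2)).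
rewrite (stoch_isometry hf hPhi (is_stoch_intB hf hPhi S1 S2)).
suff -> : (fun x => real_complex R (\1_B x) *: delta_mx 0 c -
    \sum_(q <- p) q.1 *: (expi (x * q.2) *: delta_mx 0 c)) =
    (fun x => (real_complex R (\1_B x) - tpoly p x) *: (delta_mx 0 c : 'rV_k)).
  exact: pP.
apply/funext => x; rewrite scalerBl; congr (_ - _).
by rewrite /tpoly scaler_suml; apply: eq_bigr => q _; rewrite scalerA.
Qed.

Lemma linspace_stoch_int (C : {set 'I_k}) psi X :
  is_stoch_int P (fsub f C C) (Phisub Phi C) psi X -> linspace Y C X.
Proof.
have hfC := cintegrable_fsub (C := C) hf; have hPC := random_orthogonal_measure_sub C hPhi.
move=> /(is_stoch_intP hfC hPC)[Lpsi LX H].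
apply: (ms_closure_lim (cspan_subspace C) LX) => e e0.
have [l [_ l2]] := H e e0; exists (sint (Phisub Phi C) l); last by rewrite nrm2BC.
have HL := linspace_subspace C; rewrite /sint.
have -> : (fun w => \sum_(p <- l) \sum_j p.2 0 j * Phisub Phi C j (sval p.1) w) =
  (fun w => \sum_(p <- l) 1 * \sum_j p.2 0 j * Phisub Phi C j (sval p.1) w).
  by apply/funext => w; apply: eq_bigr => p _; rewrite mul1r.
apply: (subspace_sum _ _ HL) => p; apply: (subspace_sum _ _ HL) => j.
by apply: linspace_Phi; [exact: enum_valP|exact: svalP].
Qed.

(** Polarisation: the form is real at e_a, e_b, e_a + e_b and e_a + i e_b. The third value gives Im
    f_ab = -Im f_ba, the fourth Re f_ab = Re f_ba. The pairs (a, b) are finite in number, so one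
    null set serves all u and v. *)
Lemma ae_hermitian : {ae (@lebesgue_measure R), forall x, forall u v,
  sq (f x) u v = (sq (f x) v u)^*}.
Proof.
have H a b : {ae (@lebesgue_measure R), forall x, f x a b = (f x b a)^*}.
  have psd u := ae_psd hf hPhi (rv_cmeasurable_cst u).
  have P1 := psd (delta_mx 0 a); have P2 := psd (delta_mx 0 b).
  have P3 := psd (delta_mx 0 a + delta_mx 0 b).
  have P4 := psd (delta_mx 0 a + 'i%C *: delta_mx 0 b).
  apply: (ae_imp2 _ (ae_imp2 (fun x => @conj _ _) P1 P2)
                    (ae_imp2 (fun x => @conj _ _) P3 P4)) => x [p1 p2] [p3 p4].
  move: p1 p2 p3 p4; rewrite !(sqDl, sqDr, sqZl, sqZr, sq_delta) !lecE.
  move=> /andP[/eqP e1 _] /andP[/eqP e2 _] /andP[/eqP e3 _] /andP[/eqP e4 _].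
  move: e1 e2 e3 e4; rewrite !(ReD, ImD, ReM, ImM, ReC, ImC) /= => e1 e2 e3 e4.
  by apply: complexP; rewrite ?ReC ?ImC; lra.
have {}H := ae_forall_fin (fun b => ae_forall_fin (H ^~ b)).
apply: ae_imp H => x E u v; rewrite !sqE rmorph_sum exchange_big /=.
apply: eq_bigr => i _; rewrite rmorph_sum; apply: eq_bigr => j _.
by rewrite !rmorphM /= conjCK (E i j); congr (_ * _); rewrite mulrC.
Qed.

Variable C : {set 'I_k}.
Hypothesis hC : forall l : R, posdefmx (fsub f C C l).

(** The transfer function of the noncausal Wiener filter: at each frequency, the regression
    coefficients of component a on those in [C]. *)
Definition wiener (a : 'I_k) (l : R) : 'rV[R[i]]_#|C| :=
  frow f a C l *m invmx (fsub f C C l).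

Definition residual (a : 'I_k) (l : R) : 'rV[R[i]]_k := delta_mx 0 a - emb (wiener a l).

(** The normal equations, from (f_aC f_CC^-1) f_CC = f_aC. They hold at every frequency; with the
    arguments of the form exchanged, hermitian symmetry is used and the identity is obtained almost
    everywhere. *)
Lemma residual_orth a x (u : 'rV[R[i]]_#|C|) : sq (f x) (residual a x) (emb u) = 0.
Proof.
have E : sq (fsub f C C x) (wiener a x) u = (frow f a C x *m u^t*) 0 0.
  by rewrite /sq /wiener mulmxKV //; exact: (posdefmx_unit (hC x)).
rewrite /residual sqDl sqNl sq_emb E {1}/emb sq_sumr [X in _ - X]mxE.
apply/eqP; rewrite subr_eq0; apply/eqP; apply: eq_bigr => j _.
by rewrite sqZr sq_delta !mxE mulrC.
Qed.

Lemma rv_cmeasurable_wiener a : rv_cmeasurable (wiener a).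
Proof.
move=> j; under eq_fun do rewrite mxE; apply: cmeasurable_sum => i.
apply: cmeasurableM; first by under eq_fun do rewrite mxE; exact: cintegrable_measurable (hf _ _).
apply: cmeasurable_invmx => [a' b'|x]; last exact: (posdefmx_unit (hC x)).
exact: cintegrable_measurable (cintegrable_fsub (C := C) hf a' b').
Qed.

Lemma L2spec_wiener a : L2spec (fsub f C C) (wiener a).
Proof.
have mphi := rv_cmeasurable_wiener a; have hfC := cintegrable_fsub (C := C) hf.
apply/(L2specP hfC); split; first exact: mphi.
have mres : rv_cmeasurable (residual a).
  apply: rv_cmeasurableB; first exact: rv_cmeasurable_cst.
  exact: rv_cmeasurable_emb.
have psdC := ae_psd hfC (random_orthogonal_measure_sub C hPhi) mphi.
apply: (rintegrable_le_ae _ _ _ (rintegrable_normc (hf a a))).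
- exact: (measurable_normc_sq hfC mphi).
- by move=> x; exact: normc_ge0.
apply: (ae_imp2 _ (ae_imp2 (fun x => @conj _ _) (ae_psd hf hPhi mres) psdC) ae_hermitian)
  => x [p1 p2] herm.
(* The Schur complement of f_CC in the matrix bordered by a. Its nonnegativity bounds the form of
   the Wiener row by the integrable f_aa. *)
have E : sq (f x) (residual a x) (residual a x) =
    f x a a - sq (fsub f C C x) (wiener a x) (wiener a x).
  rewrite {2}/residual sqDr sqNr residual_orth subr0.
  rewrite {1}/residual sqDl sqNl sq_delta -sq_emb; congr (_ - _).
  rewrite herm; have := residual_orth a x (wiener a x).
  rewrite /residual sqDl sqNl => /eqP; rewrite subr_eq0 => /eqP ->.
  by rewrite -herm.
rewrite (normc_Re_ge0 p2); move: p1; rewrite E lecE => /andP[_].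
rewrite /= ReD ReN subr_ge0 => /le_trans; apply.
exact: le_trans (ler_norm _) (normr_Re_le _).
Qed.

Lemma L2spec_modulate t psi :
  L2spec (fsub f C C) psi -> L2spec (fsub f C C) (modulate t psi).
Proof.
apply: (L2specM (cintegrable_fsub (C := C) hf) (cmeasurable_expiM t) (K := 1)).
by move=> x; rewrite sqmod_expi.
Qed.

Definition mod_int (t : R) (psi : R -> 'rV[R[i]]_#|C|) : T -> R[i] :=
  stoch_int P (fsub f C C) (Phisub Phi C) (modulate t psi).

Lemma mod_intP t psi : L2spec (fsub f C C) psi ->
  is_stoch_int P (fsub f C C) (Phisub Phi C) (modulate t psi) (mod_int t psi).
Proof.
move=> Lpsi; exact: (stoch_intP (cintegrable_fsub (C := C) hf)
  (random_orthogonal_measure_sub C hPhi) (L2spec_modulate t Lpsi)).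
Qed.

Lemma linspace_mod_int t psi : L2spec (fsub f C C) psi -> linspace Y C (mod_int t psi).
Proof. by move=> Lpsi; exact: (linspace_stoch_int (mod_intP t Lpsi)). Qed.

Lemma residual_stoch_int a t :
  is_stoch_int P f Phi (fun x => expi (x * t) *: residual a x)
    (fun w => Yc Y a t w - mod_int t (wiener a) w).
Proof.
have := is_stoch_intB hf hPhi (Yc_stoch_int a t)
  (is_stoch_int_emb hf hPhi (mod_intP t (L2spec_wiener a))).
suff -> : (fun x => expi (x * t) *: delta_mx 0 a - emb (modulate t (wiener a) x)) =
    (fun x => expi (x * t) *: residual a x) by [].
by apply/funext => x; rewrite /modulate embZ scalerBr.
Qed.

Lemma cspan_stoch_int S : cspan Y C S ->
  exists psi : R -> 'rV[R[i]]_#|C|, is_stoch_int P f Phi (fun x => emb (psi x)) S.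
Proof.
move=> [n [z [c [s [cC ->]]]]].
exists (fun x => \sum_(i < n) z i *:
  (expi (x * s i) *: delta_mx 0 (enum_rank_in (cC i) (c i)))).
have := is_stoch_int_sum hf hPhi (index_enum 'I_n)
  (fun i => is_stoch_intZ hf hPhi (z i) (Yc_stoch_int (c i) (s i))).
suff -> : (fun x => \sum_(i < n) z i *: (expi (x * s i) *: delta_mx 0 (c i))) =
  (fun x => emb (\sum_(i < n) z i *:
    (expi (x * s i) *: delta_mx 0 (enum_rank_in (cC i) (c i))))) by [].
apply/funext => x; rewrite emb_sum; apply: eq_bigr => i _.
by rewrite !embZ emb_delta enum_rankK_in.
Qed.

Lemma is_orth_proj_mod_int a t :
  is_orth_proj P (linspace Y C) (Yc Y a t) (mod_int t (wiener a)).
Proof.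
split; first exact: (linspace_mod_int t (L2spec_wiener a)).
move=> W; have SD := residual_stoch_int a t; have [LD LDX _] := SD.
(* By continuity it suffices to test against finite combinations of the Y_c(s), which have an
   explicit spectral row supported in [C]. *)
apply: (inner0_closure (cspan_subspace C) LDX) => S.
move=> /cspan_stoch_int[psi Spsi]; have [_ LS _] := Spsi.
apply: (pythagoras_inner0 LDX LS) => z; have SZ := is_stoch_intZ hf hPhi z Spsi.
have [LZ _ _] := SZ.
have SDZ := is_stoch_intD hf hPhi SD SZ; have [LDZ _ _] := SDZ.
rewrite (stoch_isometry hf hPhi SDZ) (stoch_isometry hf hPhi SD).
rewrite (stoch_isometry hf hPhi SZ) !(qnE hf hPhi) //.
have [mD _] := LD; have [mZ _] := LZ; have [mDZ _] := LDZ.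
have iRe chi : L2spec f chi ->
    rintegrable lebesgue_measure (fun x => complex.Re (sq (f x) (chi x) (chi x))).
  move=> /(L2specP hf)[mchi ichi]; apply: (rintegrable_le _ _ ichi).
    have mf a' b' := cintegrable_measurable (hf a' b').
    by have [] := cmeasurable_sq mf mchi mchi.
  by move=> x; exact: normr_Re_le.
rewrite -(rintD (iRe _ LD) (iRe _ LZ)).
have iD := rintegrableD (iRe _ LD) (iRe _ LZ).
apply: rint_ae_eq; [exact: rintegrable_measurable (iRe _ LDZ)|
  exact: rintegrable_measurable iD|].
apply: ae_imp ae_hermitian => x herm _.
(* One cross term vanishes by the normal equations, the other by hermitian symmetry; this is
   Pythagoras under the integral. *)
have O : sq (f x) (expi (x * t) *: residual a x) (z *: emb (psi x)) = 0.
  by rewrite sqZl sqZr residual_orth !mulr0.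
by rewrite sqDl !sqDr O (herm (z *: _)) O rmorph0 add0r addr0 ReD.
Qed.
End SpectralProjection.

Theorem proposition3p3 (R : realType) (d : measure_display)
    (T : measurableType d) (P : probability T R) (k : nat)
    (Y : 'I_k -> R -> {RV P >-> R})
    (f : R -> 'M[R[i]]_k) (Phi : 'I_k -> set R -> T -> R[i])
    (hY : centered_wss_msc Y)
    (hf : is_spectral_density Y f)
    (hPhi : random_orthogonal_measure P f Phi)
    (hYPhi : spectral_representation Y f Phi)
    (a : 'I_k) (A C : {set 'I_k})
    (hC : forall l : R, posdefmx (fsub f C C l)) :
  let int_C (t : R) (phi : R -> 'rV[R[i]]_#|C|) :=
    stoch_int P (fsub f C C) (Phisub Phi C) (modulate t phi) in
  let phi_aC := fun l : R => frow f a C l *m invmx (fsub f C C l) in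
  let proj := orth_proj P (linspace Y C) in
  forall t : R,
  [/\ L2spec (fsub f C C) phi_aC /\
      ae_eq P setT (proj (Yc Y a t)) (int_C t phi_aC),
      (exists phi, is_minimiser (L2spec (fsub f C C))
         (fun psi => ms_dist P (Yc Y a t) (int_C t psi)) phi) /\
      (forall phi, L2spec (fsub f C C) phi ->
         (is_minimiser (L2spec (fsub f C C))
            (fun psi => ms_dist P (Yc Y a t) (int_C t psi)) phi <->
          ae_eq P setT (proj (Yc Y a t)) (int_C t phi))) &
      forall i : 'I_#|A|,
        ae_eq P setT
          (vec_orth_proj P (linspace Y C) (fun j : 'I_#|A| => Yc Y (enum_val j) t) i)
          (proj (Yc Y (enum_val i) t))].
Proof.
move=> intC phi proj t; have hf' := sd_integrable hf.
have HL := linspace_subspace hf' hPhi hYPhi C.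
have LY b := L2rv_Yc hf' hPhi hYPhi b t.
have oZ b := is_orth_proj_mod_int hf' hPhi hYPhi hC b t.
have oP b := orth_projP (oZ b).
have projZ : ae_eq P setT (proj (Yc Y a t)) (intC t phi).
  exact: (is_orth_proj_unique HL (LY a) (oP a) (oZ a)).
have Lphi : L2spec (fsub f C C) phi := L2spec_wiener hf' hPhi hC a.
have LI psi : L2spec (fsub f C C) psi -> linspace Y C (intC t psi).
  exact: (linspace_mod_int hf' hPhi hYPhi t).
have LI2 psi (Lpsi : L2spec (fsub f C C) psi) := subspace_L2 HL (LI psi Lpsi).
(* The error of the projection is orthogonal to every competing integral, so the cost is a constant
   plus [dist psi], and minimising the cost means minimising [dist]. *)
pose dist psi := nrm2 P (fun w => intC t phi w - intC t psi w).
have cost psi : L2spec (fsub f C C) psi -> ms_dist P (Yc Y a t) (intC t psi) =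
    (nrm2 P (fun w => Yc Y a t w - intC t phi w) + dist psi)%:E.
  move=> Lpsi; rewrite (ms_distE (LY a) (LI2 _ Lpsi)); congr EFin.
  have LB := subspaceB HL (LI _ Lphi) (LI _ Lpsi).
  rewrite -(inner0_pythagoras (L2rvB (LY a) (LI2 _ Lphi)) (subspace_L2 HL LB)).
    by congr nrm2; apply/funext => w; rewrite addrA subrK.
  by have [_ o] := oZ a; exact: (o _ LB).
have cost_le psi chi (Lpsi : L2spec (fsub f C C) psi) (Lchi : L2spec (fsub f C C) chi) :
    (ms_dist P (Yc Y a t) (intC t psi) <= ms_dist P (Yc Y a t) (intC t chi))%E =
    (dist psi <= dist chi).
  exact: (etrans (congr2 (fun u v => (u <= v)%E) (cost _ Lpsi) (cost _ Lchi))
    (etrans (lee_fin _ _) (lerD2l _ _ _))).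
have dist_ge0 psi : 0 <= dist psi by exact: nrm2_ge0.
have dist0 : dist phi = 0.
  rewrite /dist /nrm2; under eq_fun do rewrite subrr sqmodE /= expr0n addr0.
  exact: rint0.
split; first by split; [exact: Lphi|exact: projZ].
- split.
    exists phi; split; first exact: Lphi.
    move=> psi Lpsi; apply: (etrans (cost_le _ _ Lphi Lpsi)).
    by rewrite dist0; exact: dist_ge0.
  (* As [dist phi = 0], a minimiser has distance 0, which is almost sure equality of the integrals.
     Conversely, almost sure equality with the projection makes [dist psi] vanish. *)
  move=> psi Lpsi; split=> [[_ m]|projpsi].
    apply: ae_eq_trans projZ _; apply: (nrm2_eq0 (LI2 _ Lphi) (LI2 _ Lpsi)).
    have d0 : dist psi <= 0.
      by rewrite -dist0; exact: (etrans (esym (cost_le _ _ Lpsi Lphi)) (m phi Lphi)).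
    by apply: le_anti; apply/andP; split; [exact: d0|exact: dist_ge0].
  split; first exact: Lpsi.
  move=> chi Lchi; apply: (etrans (cost_le _ _ Lpsi Lchi)).
  suff -> : dist psi = 0 by exact: dist_ge0.
  rewrite -dist0; apply: nrm2_ae_eq.
  - exact: L2rv_cmeasurable (L2rvB (LI2 _ Lphi) (LI2 _ Lpsi)).
  - exact: L2rv_cmeasurable (L2rvB (LI2 _ Lphi) (LI2 _ Lphi)).
  have /ae_eq_sym E := projpsi; have E2 := ae_eq_trans E projZ.
  by apply: ae_imp E2 => w Ew Tw; rewrite Ew.
move=> i; apply: (vec_orth_proj_ae (Z := fun j => proj (Yc Y (enum_val j) t)) i HL).
  by move=> j; exact: LY.
by move=> j; exact: oP.
Qed.
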